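(* There is an absolute constant $C>0$ such that for every $k \in \mathbb{N}$ there exists a polynomial $\mathrm{q}$ of degree at most $C \cdot k^3 \cdot (8k^2)^{k+2}$ with the following property: every graph $G$ that is $k$-creature-free and does not contain the $k$-skinny-ladder as an induced minor has at most $\mathrm{q}(|V(G)|)$ minimal separators.
   Context: All graphs are finite and simple. For $S\subseteq V(G)$, a connected component $A$ of $G-S$ is full to $S$ if $N(A)=S$. A set $S \subseteq V(G)$ is a minimal separator of $G$ if $G-S$ has at least two connected components that are full to $S$ (equivalently, $S$ is an inclusion-minimal set separating some pair of vertices $u,v$). A $k$-creature in $G$ is a tuple $(A,B,X,Y)$ of pairwise disjoint nonempty subsets of $V(G)$ such that: (i) $G[A]$ and $G[B]$ are connected; (ii) there are no edges between $A$ and $Y\cup B$, and no edges between $B$ and $A\cup X$; (iii) every $x\in X$ has a neighbor in $A$ and every $y \in Y$ has a neighbor in $B$; (iv) $|X|=|Y|=k$ and one can enumerate $X=\{x_1,\dots,x_k\}$, $Y=\{y_1,\dots,y_k\}$ so that $x_iy_j\in E(G)$ if and only if $i=j$. $G$ is $k$-creature-free if it has no $k$-creature. The $k$-skinny-ladder is the graph with vertex set $\{p_1,\dots,p_k,q_1,\dots,q_k,r_1,\dots,r_k\}$ whose edges are exactly $p_ip_{i+1}$ and $q_iq_{i+1}$ for $1\le i<k$, and $p_ir_i$, $q_ir_i$ for $1 \le i \le k$ (so $p_1\dots p_k$ and $q_1\dots q_k$ are induced paths with no edges between them, and $\{r_1,\dots,r_k\}$ is independent). A graph $H$ is an induced minor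 of $G$ if $H$ is isomorphic to a graph obtained from $G$ by a sequence of vertex deletions and edge contractions. *)

(* Defs.v *)
From mathcomp Require Import all_boot.

Set Implicit Arguments.
Unset Strict Implicit.
Unset Printing Implicit Defensive.

Record sgraph := SGraph {
  vertex :> finType;
  edge : rel vertex;
  edge_sym : symmetric edge;
  edge_irrefl : irreflexive edge }.

Section Separators.
Variable G : sgraph.
Implicit Types (S U W A B X Y : {set G}).

Definition nbhd A : {set G} :=
  [set y | (y \notin A) && [exists x in A, edge x y]].

Definition induced_rel U : rel G := [rel x y in U | edge x y].

Definition connected_in U : Prop :=
  U != set0 /\ {in U &, forall x y, connect (induced_rel U) x y}.

(* The connected components of G - S, as a set of vertex sets. *)
Definition components S : {set {set G}} :=
  equivalence_partition (connect (induced_rel (~: S))) (~: S).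

Definition full_components S : {set {set G}} :=
  [set A in components S | nbhd A == S].

Definition minimal_separator S : bool := 1 < #|full_components S|.

Definition anticomplete U W : Prop := {in U & W, forall x y, ~~ edge x y}.

Record is_creature (k : nat) A B X Y : Prop := IsCreature {
  creature_nonempty : all (fun U => U != set0) [:: A; B; X; Y];
  creature_disjoint :
    pairwise (fun U W => [disjoint U & W]) [:: A; B; X; Y];
  creature_connA : connected_in A;
  creature_connB : connected_in B;
  creature_antiA : anticomplete A (Y :|: B);
  creature_antiB : anticomplete B (A :|: X);
  creature_nbrX : {in X, forall x, exists2 a, a \in A & edge x a};
  creature_nbrY : {in Y, forall y, exists2 b, b \in B & edge y b};
  creature_cardX : #|X| = k;
  creature_cardY : #|Y| = k;
  creature_matching : exists x y : 'I_k -> G,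
    [/\ X = [set x i | i : 'I_k], Y = [set y i | i : 'I_k]
      & forall i j, edge (x i) (y j) = (i == j)] }.

Definition creature_free (k : nat) : Prop :=
  forall A B X Y, ~ is_creature k A B X Y.

End Separators.

Definition isomorphic (H G : sgraph) : Prop :=
  exists2 f : H -> G, bijective f & forall x y, edge (f x) (f y) = edge x y.

Section Minors.
Variable G : sgraph.

Section Delete.
Variable v : G.

Definition del_edge : rel {x : G | x != v} := [rel x y | edge (val x) (val y)].

Lemma del_edge_sym : symmetric del_edge.
Proof. by move=> x y; exact: edge_sym. Qed.

Lemma del_edge_irrefl : irreflexive del_edge.
Proof. by move=> x; exact: edge_irrefl. Qed.

Definition del_vertex : sgraph := SGraph del_edge_sym del_edge_irrefl.
End Delete.

Section Contract.
Variables u v : G.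

(* Contraction of the edge uv: v is removed and u plays the role of the merged
   vertex, inheriting the neighbours of v. *)
Definition contract_edge : rel {x : G | x != v} :=
  [rel x y | (x != y) &&
    [|| edge (val x) (val y),
        (val x == u) && edge v (val y)
      | (val y == u) && edge v (val x)]].

Lemma contract_edge_sym : symmetric contract_edge.
Proof. by move=> x y; rewrite /contract_edge /= eq_sym edge_sym [X in _ || X]orbC. Qed.

Lemma contract_edge_irrefl : irreflexive contract_edge.
Proof. by move=> x; rewrite /contract_edge /= eqxx. Qed.

Definition contract : sgraph := SGraph contract_edge_sym contract_edge_irrefl.
End Contract.
End Minors.

Inductive induced_minor (H : sgraph) : sgraph -> Prop :=
| IMiso (G : sgraph) : isomorphic H G -> induced_minor H G
| IMdel (G : sgraph) (v : G) :
    induced_minor H (del_vertex v) -> induced_minor H G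
| IMcontract (G : sgraph) (u v : G) :
    edge u v -> induced_minor H (contract u v) -> induced_minor H G.

Section SkinnyLadder.
Variable k : nat.

(* [inl (inl i)], [inl (inr i)] and [inr i] stand for the vertices p_i, q_i and
   r_i, with indices running from 0 to k - 1. *)
Definition ladder_vertex : finType := ('I_k + 'I_k + 'I_k)%type.

Definition ladder_arc (a b : ladder_vertex) : bool :=
  match a, b with
  | inl (inl i), inl (inl j) => i.+1 == j :> nat
  | inl (inr i), inl (inr j) => i.+1 == j :> nat
  | inl (inl i), inr j => i == j
  | inl (inr i), inr j => i == j
  | _, _ => false
  end.

Definition ladder_edge : rel ladder_vertex :=
  [rel a b | ladder_arc a b || ladder_arc b a].

Lemma ladder_edge_sym : symmetric ladder_edge.
Proof. by move=> a b; rewrite /ladder_edge /= orbC. Qed.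

Lemma ladder_edge_irrefl : irreflexive ladder_edge.
Proof. by move=> [[i|i]|i] //=; rewrite /ladder_edge /= orbb eqn_leq ltnn. Qed.

Definition skinny_ladder : sgraph :=
  SGraph ladder_edge_sym ladder_edge_irrefl.
End SkinnyLadder.

(* Main.v *)
(* Let S be a minimal separator with full components A and B.  It suffices to
   describe, by boundedly many vertices, a set C inside A that dominates S: then S
   is the neighbourhood of a component of G - N[C].

   Fix a minimal connected A' in A dominating S and work downwards: given a
   connected K in A' and the part T of S not yet discarded, take a maximal
   connected K2 in K that fails to dominate T, a neighbour v of K2, and e in T not
   adjacent to K2.  Discard the neighbours of e, and those of boundedly many
   vertices chosen (by creature-freeness) so that no remaining vertex of T shares a
   neighbour with e in A' or B; continue with K2.  The vertices e are independent
   and pairwise without common neighbours, and they all touch A' and B.  If there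
   were many, many of them would touch the same induced path in A' and the same
   induced path in B; cutting both paths repeatedly gives either a skinny ladder
   or two of these vertices e, e' joined through k separated subpaths, which is a
   k-creature.

   Going back up, suppose C containing K2 is known.  Then S is dominated by C
   together with boundedly many known vertices, so the components of what remains
   of B are known; by creature-freeness boundedly many of them dominate the part
   of S not adjacent to the vertices e, and removing their neighbourhoods reveals a
   set containing K. *)

Require Import Defs.
From mathcomp Require Import all_boot all_order all_algebra zify.
From mathcomp Require Import reals.
Import Order.TTheory GRing.Theory Num.Theory.

Set Implicit Arguments.
Unset Strict Implicit.
Unset Printing Implicit Defensive.


(** * Connected sets *)

Section Connectivity.
Variable G : sgraph.
Implicit Types (A B D K S W X Y Z : {set G}) (a b t u v x y : G).

(** Every appeal to creature-freeness rests on [private_roads_false], mostly through one covering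
    principle, [road_cover]: if connected roads start at a hub, and each vertex of a set Y touches a
    road and a connected far side but not the hub, then fewer than k of the roads touch all of Y.
    Only hub, roads and far side vary. Minimality of A' makes A' sparse: a connected subset has
    fewer than k neighbours in A' ([frontier_small]), so bounded guesses can contain the part of A'
    in the closed neighbourhood of few vertices. The obstacle on the way up is that a set grown from
    guessed seeds must not leak through the unknown S. It may only grow outside a region certain to
    contain S, and such regions are obtained alternately from the A side and from the B side. The
    number of exposed vertices stays below N = [chain_bound k], so there are N rounds, each guessing
    four sets of at most m = 4 k^2 N vertices. With n = |V(G)| this gives at most (n+1)^(4mN)
    results, and one more vertex names the component of G - N[C]: the exponent is 16 k^2 N^2 + 1. *)

Definition touch t W := [exists x in W, edge t x].

Lemma touchP t W : reflect (exists2 x, x \in W & edge t x) (touch t W).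
Proof. exact: 'exists_in_idP. Qed.

Lemma touch_sub t W Z : W \subset Z -> touch t W -> touch t Z.
Proof. by move=> /subsetP sWZ /touchP[x /sWZ ? ?]; apply/touchP; exists x. Qed.

Lemma touchU t W Z : touch t (W :|: Z) = touch t W || touch t Z.
Proof.
apply/idP/orP => [/touchP[x]|[]].
- by rewrite inE => /orP[] ? ?; [left|right]; apply/touchP; exists x.
- by apply: touch_sub; apply: subsetUl.
- by apply: touch_sub; apply: subsetUr.
Qed.

Lemma touch1 t x : touch t [set x] = edge t x.
Proof.
by apply/touchP/idP => [[y /set1P->]|tx] //; exists x; rewrite ?set11.
Qed.

Lemma touch0 t : touch t set0 = false.
Proof. by apply/touchP => -[x]; rewrite inE. Qed.

Lemma touchNP t W : reflect {in W, forall x, ~~ edge t x} (~~ touch t W).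
Proof.
apply: (iffP idP) => [nt x xW|nt].
  by apply: contra nt => tx; apply/touchP; exists x.
by apply/touchP => -[x xW]; apply/negP/nt.
Qed.

Lemma in_nbhd A y : (y \in nbhd A) = (y \notin A) && touch y A.
Proof.
rewrite inE; congr andb; apply/existsP/touchP => [[x /andP[? ?]]|[x ? ?]].
  by exists x; rewrite // edge_sym.
by exists x; rewrite edge_sym; apply/andP.
Qed.

Lemma anticompleteC A B : anticomplete A B -> anticomplete B A.
Proof. by move=> AB x y xB yA; rewrite edge_sym AB. Qed.

Lemma anticompleteS A A' B B' : A' \subset A -> B' \subset B ->
  anticomplete A B -> anticomplete A' B'.
Proof. by move=> /subsetP sA /subsetP sB AB x y /sA xA /sB yB; apply: AB. Qed.

Lemma connected_ind W Z x : connected_in W -> x \in W -> x \in Z ->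
  (forall a b, a \in W -> a \in Z -> b \in W -> edge a b -> b \in Z) ->
  W \subset Z.
Proof.
move=> [_ cW] xW xZ closedZ; apply/subsetP => y yW.
have /connectP[p] := cW x y xW yW.
elim: p x {xW} xZ => [|z p IHp] x xZ /=; first by move=> _ ->.
case/andP => /andP[/andP[xW zW] xz] pP yE.
by apply: IHp pP yE; apply: closedZ xz.
Qed.

Lemma connected_intro W x : x \in W ->
  (forall Z, x \in Z ->
     (forall a b, a \in W -> a \in Z -> b \in W -> edge a b -> b \in Z) ->
     W \subset Z) ->
  connected_in W.
Proof.
move=> xW indW; split; first by apply/set0Pn; exists x.
have symW : connect_sym (induced_rel W).
  by apply: sym_connect_sym => a b; rewrite /induced_rel /= edge_sym [(b \in W) && _]andbC.
have from_x y : y \in W -> connect (induced_rel W) x y.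
  have /subsetP sub : W \subset [set y | connect (induced_rel W) x y].
    apply: indW => [|a b aW]; first by rewrite inE connect0.
    rewrite !inE => xa bW ab; apply: connect_trans xa (connect1 _).
    by rewrite /induced_rel /= aW bW.
  by move/sub; rewrite inE.
by move=> y z yW zW; apply: connect_trans (from_x z zW); rewrite symW from_x.
Qed.

Lemma connected_exit W Z x y : connected_in W -> x \in W -> x \in Z ->
  y \in W -> y \notin Z ->
  exists a b, [/\ a \in W, a \in Z, b \in W, b \notin Z & edge a b].
Proof.
move=> cW xW xZ yW yNZ.
case: (pickP (fun ab : G * G => [&& ab.1 \in W, ab.1 \in Z, ab.2 \in W,
   ab.2 \notin Z & edge ab.1 ab.2])) => [[a b] /= /and5P[*]|none].
  by exists a, b.
case/negP: yNZ; apply: subsetP yW; apply: connected_ind cW xW xZ _.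
move=> a b aW aZ bW ab; apply: contraFT (none (a, b)) => /= bNZ.
by rewrite aW aZ bW bNZ.
Qed.

Lemma connected1 x : connected_in [set x].
Proof.
apply: (@connected_intro _ x); first exact: set11.
by move=> Z xZ _; rewrite sub1set.
Qed.

Lemma connectedU W1 W2 x y : connected_in W1 -> connected_in W2 ->
  x \in W1 -> y \in W2 -> (x == y) || edge x y -> connected_in (W1 :|: W2).
Proof.
move=> c1 c2 x1 y2 xy; apply: (@connected_intro _ x); first by rewrite inE x1.
move=> Z xZ closedZ.
have s1 : W1 \subset Z.
  by apply: connected_ind c1 x1 xZ _ => a b a1 aZ b1;
     apply: closedZ; rewrite ?inE ?a1 ?b1.
rewrite subUset s1 /=.
have yZ : y \in Z.
  case/orP: xy => [/eqP<- //|xy].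
  by apply: closedZ xy; rewrite ?inE ?x1 ?y2 ?orbT.
by apply: connected_ind c2 y2 yZ _ => a b a1 aZ b1;
   apply: closedZ; rewrite ?inE ?a1 ?b1 ?orbT.
Qed.

Lemma connected_add W x : connected_in W -> touch x W -> connected_in (x |: W).
Proof.
move=> cW /touchP[y yW xy].
by apply: connectedU (connected1 x) cW (set11 x) yW _; rewrite xy orbT.
Qed.

(** The union of those components of the graph induced on K and D together that meet K. It serves to
    extend a hub by stretches of roads, and to recover a set from seeds K when D is known to avoid a
    barrier. *)
Definition grow K D : {set G} :=
  [set x | [exists a in K, connect (induced_rel (K :|: D)) a x]].

Lemma grow_base K D : K \subset grow K D.
Proof.
by apply/subsetP => x xK; rewrite inE; apply/exists_inP; exists x.
Qed.

Lemma grow_ind K D Z : K \subset Z ->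
  (forall a b, a \in Z -> b \in D -> edge a b -> b \in Z) ->
  grow K D \subset Z.
Proof.
move=> /subsetP sKZ closedZ; apply/subsetP => y; rewrite inE.
case/exists_inP => a /sKZ aZ /connectP[p].
elim: p a aZ => [|z p IHp] x xZ /=; first by move=> _ ->.
case/andP => /andP[/andP[xW zW] xz] pP yE; apply: IHp pP yE.
move: zW; rewrite inE => /orP[/sKZ //|zD]; exact: closedZ xz.
Qed.

Lemma grow_sub K D : grow K D \subset K :|: D.
Proof.
by apply: grow_ind => [|a b _ bD _]; rewrite ?subsetUl // inE bD orbT.
Qed.

Lemma grow_step K D a b : a \in grow K D -> b \in D -> edge a b ->
  b \in grow K D.
Proof.
move=> aG bD ab; have := subsetP (grow_sub K D) _ aG.
move: aG; rewrite !inE => /exists_inP[c cK ca] aKD.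
apply/exists_inP; exists c => //; apply: connect_trans ca (connect1 _).
by rewrite /induced_rel /= !inE aKD bD orbT.
Qed.

Lemma grow_absorb K D W x : connected_in W -> W \subset D -> x \in W ->
  x \in grow K D -> W \subset grow K D.
Proof.
move=> cW /subsetP sWD xW xG; apply: connected_ind cW xW xG _ => a b _ aG bW.
by apply: grow_step => //; apply: sWD.
Qed.

Lemma grow_connected K D : connected_in K -> connected_in (grow K D).
Proof.
move=> cK; have [/set0Pn[x xK] _] := cK.
have sKG := grow_base K D; have xG := subsetP sKG _ xK.
apply: (connected_intro xG) => Z xZ closedZ.
have sKZ : K \subset Z.
  apply: connected_ind cK xK xZ _ => a b aK aZ bK.
  by apply: closedZ; rewrite ?(subsetP sKG).
suff: grow K D \subset Z :&: grow K D by rewrite subsetI => /andP[].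
apply: grow_ind => [|a b]; first by rewrite subsetI sKZ.
rewrite !in_setI => /andP[aZ aG] bD ab.
have bG := grow_step aG bD ab.
by rewrite bG andbT; apply: closedZ ab.
Qed.

Lemma grow_mono K K' D D' : K \subset K' -> D \subset D' ->
  grow K D \subset grow K' D'.
Proof.
move=> sK /subsetP sD; apply: grow_ind => [|a b aG /sD bD ab].
  exact: subset_trans sK (grow_base _ _).
exact: grow_step ab.
Qed.

End Connectivity.


(** * Building creatures *)

Section Creatures.
Variables (G : sgraph) (k : nat).
Hypotheses (free : creature_free G k) (k_gt0 : 0 < k).
Implicit Types (A B D K S W X Y Z : {set G}) (a b t u v x y : G).

(* Cutting each road [g i] from [A0] at its first neighbour of [t i] gives a
   creature: those neighbours form [X], and the [t i] form [Y]. *)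
Lemma private_roads_false A0 B1 (g : 'I_k -> {set G}) (t : 'I_k -> G) :
  connected_in A0 -> connected_in B1 ->
  [disjoint A0 & B1] -> anticomplete A0 B1 ->
  (forall i, connected_in (g i)) ->
  (forall i, [disjoint g i & B1]) -> (forall i, anticomplete (g i) B1) ->
  (forall i, exists2 u, u \in g i & touch u A0) ->
  (forall i, ~~ touch (t i) A0) -> (forall i, touch (t i) B1) ->
  (forall i j, touch (t i) (g j) = (i == j)) -> False.
Proof.
move=> cA cB dAB acAB cg dgB acgB atg tA tB tg.
pose Y := [set t i | i : 'I_k].
pose D := [set x | [exists i, x \in g i] & ~~ touch x Y].
pose A := grow A0 D.
have tYP i x : x \in g i -> touch x Y = edge (t i) x.
  move=> xg; apply/touchP/idP => [[y /imsetP[j _ ->] xt]|tx]; last first.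
    by exists (t i); rewrite ?imset_f // edge_sym.
  have /esym/eqP <- // : true = (j == i); last by rewrite edge_sym.
  by rewrite -tg; apply/esym/touchP; exists x => //; rewrite edge_sym.
have A0Y x : x \in A0 -> ~~ touch x Y.
  move=> xA; apply/touchP => -[y /imsetP[i _ ->] xt].
  by move/touchNP/(_ x xA): (tA i); rewrite edge_sym xt.
have sA x : x \in A -> x \in A0 \/ exists i, x \in g i.
  move/(subsetP (grow_sub _ _)); rewrite !inE => /orP[|/andP[/existsP]]; by auto.
have AY x : x \in A -> ~~ touch x Y.
  move/(subsetP (grow_sub _ _)); rewrite !inE => /orP[/A0Y //|/andP[]//].
(* The road [g i] has a vertex touching [A0]. If that vertex is not adjacent to [t i], it lies in A,
   and the road must leave A to reach its neighbour of [t i]. Only adjacency to Y stops the growth,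
   and on [g i] this means adjacency to [t i]. *)
have front i : exists x, [/\ x \in g i, edge (t i) x & touch x A].
  have [u ug uA0] := atg i; have uA := touch_sub (grow_base A0 D) uA0.
  have [tu|ntu] := boolP (edge (t i) u); first by exists u.
  have uGrow : u \in A.
    have /touchP[a aA ua] := uA; apply: (grow_step aA); last by rewrite edge_sym.
    by rewrite inE (tYP i) // ntu andbT; apply/existsP; exists i.
  have /touchP[y yg ty] : touch (t i) (g i) by rewrite tg.
  have yNA : y \notin A by apply/negP => /AY; rewrite (tYP i) // ty.
  have [a [b [ag aA bg bNA ab]]] := connected_exit (cg i) ug uGrow yg yNA.
  exists b; split=> //; last by apply/touchP; exists a; rewrite // edge_sym.
  apply: contraR bNA => ntb; apply: (grow_step aA) ab.
  by rewrite inE (tYP i) // ntb andbT; apply/existsP; exists i.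
have [x xP] := fin_all_exists front.
have xg i : x i \in g i by case: (xP i).
have tx i j : edge (x i) (t j) = (i == j).
  apply/idP/eqP => [xt|<-]; last by rewrite edge_sym; case: (xP i).
  apply/esym/eqP; rewrite -tg; apply/touchP; exists (x i) => //.
  by rewrite edge_sym.
have x_inj : injective x.
  by move=> i j xE; apply/eqP; rewrite -tx xE tx.
have t_inj : injective t.
  by move=> i j tE; apply/eqP; rewrite -tx -tE tx.
have AB a : a \in A -> (a \notin B1) /\ {in B1, forall b, ~~ edge a b}.
  move=> /sA[aA|[i ai]]; last by rewrite (disjointFr (dgB i)) //; split=> // b; apply: acgB ai.
  by rewrite (disjointFr dAB) //; split=> // b; apply: acAB.
pose i0 := Ordinal k_gt0.
have tNB i : t i \notin B1.
  apply/negP => tB1; have := touch_sub (subxx (g i)); have : touch (t i) (g i) by rewrite tg.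
  by case/touchP => z zg tz; have /negP[] := acgB i z (t i) zg tB1; rewrite edge_sym.
have tNA i : t i \notin A.
  by apply/negP => /AB[_ nB]; case/touchP: (tB i) => b /nB/negP.
have tNx i j : t i != x j.
  apply/eqP => tE; case/touchP: (tB i) => b bB; rewrite tE => xb.
  by have /negP[] := acgB j _ _ (xg j) bB.
apply: (free (A := A) (B := B1) (X := [set x i | i : 'I_k]) (Y := Y)); split.
- rewrite /= andbT; apply/and4P; split; apply/set0Pn.
  + by case: (grow_connected D cA) => /set0Pn.
  + by case: cB => /set0Pn.
  + by exists (x i0); rewrite imset_f.
  + by exists (t i0); rewrite imset_f.
- rewrite /= !andbT -!andbA; apply/and5P; split; last (apply/andP; split).
  + by apply/pred0P => a /=; apply/negP => /andP[/AB[/negP]].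
  + apply/pred0P => a /=; apply/negP => /andP[/AY nt /imsetP[i _ aE]].
    by move: nt; rewrite aE (tYP i) ?xg // edge_sym tx eqxx.
  + by apply/pred0P => a /=; apply/negP => /andP[aA /imsetP[i _ aE]];
       move: (tNA i); rewrite -aE aA.
  + by apply/pred0P => a /=; apply/negP => /andP[aB /imsetP[i _ aE]];
       move: (disjointFr (dgB i) (xg i)); rewrite -aE aB.
  + by apply/pred0P => a /=; apply/negP => /andP[aB /imsetP[i _ aE]];
       move: (tNB i); rewrite -aE aB.
  + apply/pred0P => a /=; apply/negP => /andP[/imsetP[i _ ->] /imsetP[j _ tE]].
    by move: (tNx j i); rewrite tE eqxx.
- exact: grow_connected.
- exact: cB.
- move=> a y aA; rewrite inE => /orP[yY|]; last by apply: (AB a aA).2.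
  by move/AY/touchNP: aA; apply.
- move=> b a bB; rewrite inE edge_sym => /orP[/AB[_]|/imsetP[i _ ->]]; first exact.
  exact: acgB (xg i) bB.
- by move=> _ /imsetP[i _ ->]; case: (xP i) => _ _ /touchP[a]; exists a.
- by move=> _ /imsetP[i _ ->]; case/touchP: (tB i) => b; exists b.
- by rewrite card_imset // card_ord.
- by rewrite card_imset // card_ord.
- by exists x, t.
Qed.

(** In an inclusion-minimal covering subfamily each road touches some vertex of Y that no other
    chosen road touches; k such private vertices contradict [private_roads_false]. *)
Lemma road_cover (I : finType) (X : {set I}) (g : I -> {set G}) A0 B1 Y :
  connected_in A0 -> connected_in B1 ->
  [disjoint A0 & B1] -> anticomplete A0 B1 ->
  {in X, forall i, [/\ connected_in (g i), [disjoint g i & B1],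
      anticomplete (g i) B1 & exists2 u, u \in g i & touch u A0]} ->
  {in Y, forall t, [/\ ~~ touch t A0, touch t B1
      & exists2 i, i \in X & touch t (g i)]} ->
  exists M : {set I}, [/\ M \subset X, #|M| < k
    & {in Y, forall t, exists2 i, i \in M & touch t (g i)}].
Proof.
move=> cA cB dAB acAB Xg YX.
pose covers (M : {set I}) := [forall t in Y, exists i in M, touch t (g i)].
have coversX : covers X.
  by apply/forall_inP => t /YX[_ _ [i iX ti]]; apply/exists_inP; exists i.
have [M /minsetP[coverM minM] sMX] := minset_exists coversX.
exists M; split=> //; last first.
  by move=> t tY; have /forall_inP/(_ t tY)/exists_inP[i] := coverM; exists i.
rewrite ltnNge; apply/negP => kM.
pose f (j : 'I_k) := enum_val (widen_ord kM j).
have fM j : f j \in M by apply: enum_valP.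
have f_inj : injective f by move=> i j /enum_val_inj/(congr1 val)/= /val_inj.
have priv j : exists t, [/\ t \in Y, touch t (g (f j))
    & {in M, forall i, touch t (g i) -> i = f j}].
  have : ~~ covers (M :\ f j).
    apply/negP => /minM /(_ (subD1set _ _))/setP/(_ (f j)).
    by rewrite !inE eqxx fM.
  rewrite negb_forall_in => /exists_inP[t tY]; rewrite negb_exists_in.
  move=> /forall_inP tM; have onlyf i : i \in M -> touch t (g i) -> i = f j.
    move=> iM ti; apply/eqP; apply: contraTT ti => iNf.
    by apply: tM; rewrite !inE iNf.
  exists t; split=> //.
  have /forall_inP/(_ t tY)/exists_inP[i iM ti] := coverM.
  by rewrite -(onlyf i iM ti).
have [t tP] := fin_all_exists priv.
apply: (@private_roads_false A0 B1 (g \o f) t cA cB dAB acAB).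
- by move=> j; case: (Xg _ (subsetP sMX _ (fM j))).
- by move=> j; case: (Xg _ (subsetP sMX _ (fM j))).
- by move=> j; case: (Xg _ (subsetP sMX _ (fM j))).
- by move=> j; case: (Xg _ (subsetP sMX _ (fM j))).
- by move=> j; case: (tP j) => /YX[].
- by move=> j; case: (tP j) => /YX[].
- move=> i j; apply/idP/eqP => [tij|<-]; last by case: (tP i).
  by apply: f_inj; case: (tP i) => _ _ /(_ _ (fM j) tij).
Qed.
End Creatures.


(** * Minor models *)

Lemma connected_imset (G G' : sgraph) (f : G -> G') (W : {set G}) :
  connected_in W ->
  {in W &, forall a b, edge a b -> f a = f b \/ edge (f a) (f b)} ->
  connected_in (f @: W).
Proof.
move=> cW fW; have [/set0Pn[x xW] _] := cW.
apply: (@connected_intro _ _ (f x)); first exact: imset_f.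
move=> Z fxZ closedZ; apply/subsetP => _ /imsetP[y yW ->].
have /subsetP/(_ y yW) : W \subset [set y | f y \in Z]; last by rewrite inE.
apply: connected_ind cW xW _ _ => [|a b aW]; rewrite !inE // => fa bW ab.
case: (fW a b aW bW ab) => [<- //|]; apply: closedZ => //; exact: imset_f.
Qed.

Definition minor_model (H G : sgraph) (f : H -> {set G}) :=
  [/\ forall h, connected_in (f h),
      forall h h', h != h' -> [disjoint f h & f h']
    & forall h h', h != h' -> edge h h' = [exists x in f h, touch x (f h')]].

Section MinorSteps.
Variables (H G : sgraph) (f : H -> {set G}).
Hypothesis modelf : minor_model f.

Lemma model_disjoint h h' x : x \in f h -> x \in f h' -> h = h'.
Proof.
case: modelf => _ fD _ xh xh'; apply/eqP; apply: contraTT xh' => /fD dhh.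
by rewrite (disjointFr dhh xh).
Qed.

Lemma model_edgeP h h' : h != h' ->
  reflect (exists x y, [/\ x \in f h, y \in f h' & edge x y]) (edge h h').
Proof.
case: modelf => _ _ fE hh; rewrite (fE _ _ hh).
apply: (iffP exists_inP) => [[x xh /touchP[y]]|[x [y [xh yh xy]]]].
  by exists x, y.
by exists x => //; apply/touchP; exists y.
Qed.

Lemma model_del (v : G) : (forall h, v \notin f h) ->
  minor_model (fun h => [set x : del_vertex v | val x \in f h]).
Proof.
move=> vf; case: modelf => fC fD _.
split=> [h|h h' hh|h h' hh].
- have [/set0Pn[x xh] _] := fC h.
  have xv : x != v by apply: contraNneq (vf h) => <-.
  (* The default value is never reached on a branch set, since v lies in none. *)
  pose psi y : del_vertex v := insubd (Sub x xv : {x : G | x != v}) y.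
  have psiK y : y \in f h -> val (psi y) = y.
    by move=> yh; apply: insubdK; apply: contraNneq (vf h) => <-.
  have -> : [set x0 : del_vertex v | val x0 \in f h] = psi @: f h.
    apply/setP => y; rewrite inE; apply/idP/imsetP => [yh|[z zh ->]].
      by exists (val y) => //; apply: val_inj; rewrite psiK.
    by rewrite psiK.
  apply: connected_imset (fC h) _ => a b ah bh ab; right.
  by rewrite /edge /= /del_edge /= !psiK.
- apply/pred0P => x /=; apply/negP; rewrite !inE => /andP[xh xh'].
  by case/eqP: hh; apply: model_disjoint xh xh'.
- apply/(model_edgeP hh)/exists_inP => [[x [y [xh yh xy]]]|[x]].
    have xv : x != v by apply: contraNneq (vf h) => <-.
    have yv : y != v by apply: contraNneq (vf h') => <-.
    exists (Sub x xv : {x : G | x != v}); first by rewrite inE.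
    by apply/touchP; exists (Sub y yv : {x : G | x != v}); rewrite ?inE.
  rewrite inE => xh /touchP[y]; rewrite inE => yh xy.
  by exists (val x), (val y).
Qed.

Lemma model_contract (u v : G) h0 : u != v -> u \in f h0 -> v \in f h0 ->
  minor_model (fun h => [set x : contract u v | val x \in f h]).
Proof.
move=> uv uh0 vh0; case: modelf => fC fD _.
pose u' : {x : G | x != v} := Sub u uv.
(* The default value [u'] is where the contracted vertex v goes. *)
pose psi y : contract u v := insubd u' y.
have psiK y : y != v -> val (psi y) = y by move=> yv; apply: insubdK.
have psiv : psi v = u' by rewrite /psi /insubd insubN // eqxx.
have psif y h : (val (psi y) \in f h) = (y \in f h).
  have [->|/psiK-> //] := eqVneq y v; rewrite psiv /=.
  by apply/idP/idP => [/(model_disjoint uh0)<-|/(model_disjoint vh0)<-].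
have cE (x y : contract u v) : edge x y = (x != y) &&
      [|| edge (val x) (val y), (val x == u) && edge v (val y)
        | (val y == u) && edge v (val x)] by [].
have psiE a b : psi a != psi b -> edge a b -> edge (psi a) (psi b).
  move=> nab ab; rewrite cE nab /=.
  have [av|/psiK av] := eqVneq a v; have [bv|/psiK bv] := eqVneq b v.
  - by rewrite av bv eqxx in nab.
  - by subst a; rewrite psiv [val u']/= eqxx bv ab orbT.
  - by subst b; rewrite psiv [val u']/= eqxx av [edge v a]edge_sym ab !orbT.
  - by rewrite av bv ab.
split=> [h|h h' hh|h h' hh].
- have -> : [set x0 : contract u v | val x0 \in f h] = psi @: f h.
    apply/setP => y; rewrite inE; apply/idP/imsetP => [yh|[z zh ->]].
      by exists (val y) => //; apply: val_inj; rewrite psiK // (valP y).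
    by rewrite psif.
  apply: connected_imset (fC h) _ => a b ah bh ab.
  have [|nab] := eqVneq (psi a) (psi b); first by left.
  by right; apply: psiE.
- apply/pred0P => x /=; apply/negP; rewrite !inE => /andP[xh xh'].
  by case/eqP: hh; apply: model_disjoint xh xh'.
- apply/(model_edgeP hh)/exists_inP => [[x [y [xh yh xy]]]|[x]].
    exists (psi x); first by rewrite inE psif.
    apply/touchP; exists (psi y); first by rewrite inE psif.
    apply: psiE xy; apply: contra hh => /eqP pE; apply/eqP.
    by apply: (@model_disjoint _ _ (val (psi x))); rewrite ?psif // -(psif x) pE psif.
  rewrite inE => xh /touchP[y]; rewrite inE => yh.
  rewrite cE => /andP[_ /or3P[xy|/andP[/eqP xu vy]|/andP[/eqP yu vx]]].
  + by exists (val x), (val y).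
  + exists v, (val y); split=> //.
    have uh : u \in f h by rewrite -xu.
    by rewrite (model_disjoint uh uh0).
  + exists (val x), v; split=> //; last by rewrite (@edge_sym G).
    have uh : u \in f h' by rewrite -yu.
    by rewrite (model_disjoint uh uh0).
Qed.

Lemma model_isomorphic :
  (forall v, exists h, v \in f h) ->
  (forall h, {in f h &, forall x y, x = y}) -> isomorphic H G.
Proof.
move=> fcover f1; case: modelf => fC _ _.
have /fin_all_exists[g gP] h : exists x, x \in f h.
  by case: (fC h) => /set0Pn.
have gE h x : x \in f h -> x = g h by move=> /f1; apply.
exists g => [|x y].
  apply: inj_card_bij => [x y gxy|].
    by apply: (model_disjoint (gP x)); rewrite gxy.
  have <- : #|[set g h | h : H]| = #|G|.
    rewrite -cardsT; congr #|pred_of_set _|; apply/setP => v; rewrite inE.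
    by have [h vh] := fcover v; apply/imsetP; exists h => //; apply: gE.
  exact: leq_imset_card.
have [->|xy] := eqVneq x y; first by rewrite !edge_irrefl.
apply/idP/(model_edgeP xy) => [gxy|[a [b [/gE-> /gE-> //]]]].
by exists (g x), (g y).
Qed.
End MinorSteps.

(** Induction on the order of G. A vertex in no branch set is deleted; a branch set with two
    vertices contains an edge by connectedness, which is contracted; otherwise the branch sets are
    singletons covering G, and G is isomorphic to H. *)
Lemma minor_model_induced (H G : sgraph) (f : H -> {set G}) :
  minor_model f -> induced_minor H G.
Proof.
have [n] := ubnP #|G|; elim: n G f => // n IHn G f leGn modelf.
have smaller v : #|{: {x : G | x != v}}| < n.
  have G_gt0 : 0 < #|G| by apply/card_gt0P; exists v.
  by rewrite card_sig (cardC1 v) prednK.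
case: (pickP (fun v => [forall h, v \notin f h])) => [v /forallP vf|cover].
  by apply: (IMdel (v := v)); apply: IHn (model_del modelf vf); apply: smaller.
case: (pickP (fun t : H * (G * G) => [&& t.2.1 \in f t.1, t.2.2 \in f t.1
    & t.2.1 != t.2.2])) => [[h [x y]] /= /and3P[xh yh xy]|single].
  have cf : connected_in (f h) by case: modelf.
  have [|a [b [ah aZ bh bNZ ab]]] := connected_exit cf xh (set11 x) yh.
    by rewrite inE eq_sym.
  have a_b : a != b by apply: contraNneq bNZ => <-.
  apply: (IMcontract ab); apply: IHn (model_contract modelf a_b ah bh).
  exact: smaller.
apply: IMiso; apply: (model_isomorphic modelf) => [v|h x y xh yh].
  by have /forallPn[h] := negbT (cover v); rewrite negbK; exists h.
by have /and3P := single (h, (x, y)) => /= ns; apply/eqP; apply: contraT => xy; case: ns.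
Qed.


(** * Words: paths read as sequences of the letters touching them *)

Section Words.
Variable G : sgraph.
Implicit Types (T : {set G}) (s I J : seq G) (t x y z w : G).

Definition touchs t s := has (edge t) s.

Lemma touchs_rcons t s z : touchs t (rcons s z) = touchs t s || edge t z.
Proof. by rewrite /touchs has_rcons orbC. Qed.

Lemma touchs_cat t s1 s2 : touchs t (s1 ++ s2) = touchs t s1 || touchs t s2.
Proof. exact: has_cat. Qed.

Lemma touchs_cons t x s : touchs t (x :: s) = edge t x || touchs t s.
Proof. by []. Qed.

Lemma touchs_rev t s : touchs t (rev s) = touchs t s.
Proof. exact: has_rev. Qed.

(** A vertex of the path carries at most one letter of T, while a letter may occur at several
    vertices. *)
Definition single_touch T s :=
  {in s, forall x, {in T &, forall t t', edge t x -> edge t' x -> t = t'}}.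

Definition all_touch T s := {in T, forall t, touchs t s}.

Lemma single_touchS T T' s s' : T' \subset T -> {subset s' <= s} ->
  single_touch T s -> single_touch T' s'.
Proof.
move=> /subsetP sT ss H x /ss xs t t' /sT tT /sT tT'; exact: H xs t t' tT tT'.
Qed.

Lemma all_touchS T T' s : T' \subset T -> all_touch T s -> all_touch T' s.
Proof. by move=> /subsetP sT H t /sT/H. Qed.

(** When every letter occurs in the word cut at z, the letters of [left_of] occur only before z,
    those of [right_of] only after z, and those of [both_of] on both sides. *)
Definition left_of T z s2 := [set t in T | ~~ touchs t (z :: s2)].
Definition right_of T s1 z := [set t in T | ~~ touchs t (rcons s1 z)].
Definition both_of T s1 s2 := [set t in T | touchs t s1 && touchs t s2].

Lemma left_ofS T z s2 : left_of T z s2 \subset T.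
Proof. by apply/subsetP => t; rewrite inE => /andP[]. Qed.
Lemma right_ofS T s1 z : right_of T s1 z \subset T.
Proof. by apply/subsetP => t; rewrite inE => /andP[]. Qed.
Lemma both_ofS T s1 s2 : both_of T s1 s2 \subset T.
Proof. by apply/subsetP => t; rewrite inE => /andP[]. Qed.

Lemma left_of_touch T s1 z s2 : all_touch T (s1 ++ z :: s2) ->
  {in left_of T z s2, forall t, touchs t s1}.
Proof.
move=> aT t; rewrite inE => /andP[/aT].
by rewrite touchs_cat => /orP[//|->].
Qed.

Lemma right_of_touch T s1 z s2 : all_touch T (s1 ++ z :: s2) ->
  all_touch (right_of T s1 z) s2.
Proof.
move=> aT t; rewrite inE => /andP[/aT].
rewrite touchs_cat touchs_cons touchs_rcons negb_or.
by case: (touchs t s1) (edge t z) => [] [].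
Qed.

Lemma single_vertex T s z : single_touch T s -> z \in s ->
  #|[set t in T | edge t z]| <= 1.
Proof.
move=> T1 zs; apply/card_le1_eqP => t t'; rewrite !inE.
by case/andP=> tT tz /andP[tT' tz']; apply: (T1 z).
Qed.

(** A letter in none of the three classes touches z, and z carries at most one letter: this is the
    summand 1. *)
Lemma cut_card T s1 z s2 : single_touch T (s1 ++ z :: s2) ->
  #|T| <= #|left_of T z s2| + #|right_of T s1 z| + #|both_of T s1 s2| + 1.
Proof.
move=> T1; have z1 : #|[set t in T | edge t z]| <= 1.
  by apply: single_vertex T1 _; rewrite mem_cat inE eqxx orbT.
apply: leq_trans (leq_add (leqnn _) z1).
apply: leq_trans (subset_leq_card (_ : T \subset left_of T z s2 :|: right_of T s1 z
  :|: both_of T s1 s2 :|: [set t in T | edge t z])) _.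
  apply/subsetP => t tT; rewrite !inE tT touchs_cons touchs_rcons /=.
  by case: (edge t z) (touchs t s1) (touchs t s2) => [] [] [].
apply: leq_trans (leq_card_setU _ _) _; rewrite leq_add2r.
apply: leq_trans (leq_card_setU _ _) _; rewrite leq_add2r.
exact: leq_card_setU.
Qed.

(** A discrete intermediate value argument: the number of letters missing from a suffix runs from 0
    to [#|T|] as the suffix shrinks, and each dropped vertex raises it by at most one. *)
Lemma cut_at T s c : single_touch T s -> all_touch T s -> c < #|T| ->
  exists s1 z s2, s = s1 ++ z :: s2 /\ #|left_of T z s2| = c.
Proof.
move=> T1 Ta cT; pose f i := #|[set t in T | ~~ touchs t (drop i s)]|.
have f0 : f 0 = 0.
  apply/eqP; rewrite cards_eq0; apply/eqP/setP => t; rewrite !inE drop0.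
  by apply/negbTE/negP => /andP[/Ta->].
have fs : c < f (size s).
  rewrite /f drop_size (_ : [set t in T | _] = T) //.
  by apply/setP => t; rewrite !inE andbT.
have [i ci mini] := ex_minnP (ex_intro (fun i => c < f i) _ fs).
case: i => [|i] in ci mini; first by rewrite f0 in ci.
have fi : f i <= c by rewrite leqNgt; apply/negP => /mini; rewrite ltnn.
have i_s : i < size s by apply: mini.
have [x0 _] : exists x0 : G, true by case: (s) i_s => // x; exists x.
pose z := nth x0 s i.
have dE : drop i s = z :: drop i.+1 s by apply: drop_nth.
exists (take i s), z, (drop i.+1 s); split; first by rewrite -dE cat_take_drop.
have -> : left_of T z (drop i.+1 s) = [set t in T | ~~ touchs t (drop i s)].
  by rewrite dE.
apply/eqP; rewrite eqn_leq fi -ltnS; apply: leq_trans ci _.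
have z1 := single_vertex T1 (mem_nth x0 i_s).
rewrite -[leqRHS]addn1; apply: leq_trans (leq_add (leqnn _) z1).
apply: leq_trans (leq_card_setU _ _); apply/subset_leq_card/subsetP => t.
by rewrite !inE dE touchs_cons => /andP[-> /negbTE->]; case: (edge t z).
Qed.

(* The chunks [p i] and [q i] become the sides of the ladder and the letters [y i]
   its rungs; both sides start at the heads of [I] and [J], so that a rung can be
   added in front. *)
Definition ladder_at n I J T :=
  exists (p q : nat -> seq G) (y : nat -> G),
  [/\ exists s, I = flatten (mkseq p n) ++ s,
      exists s, J = flatten (mkseq q n) ++ s,
      forall i, i < n -> y i \in T,
      forall i j, i < n -> j < n -> touchs (y i) (p j) = (i == j)
    & forall i j, i < n -> j < n -> touchs (y i) (q j) = (i == j)].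

Lemma ladder_at0 I J T : #|T| > 0 -> ladder_at 0 I J T.
Proof.
case/card_gt0P=> t _; exists (fun=> [::]), (fun=> [::]), (fun=> t).
by split=> //; [exists I | exists J].
Qed.

Lemma ladder_atC n I J T : ladder_at n I J T -> ladder_at n J I T.
Proof. by move=> [p [q [y [? ? ? ? ?]]]]; exists q, p, y. Qed.

Lemma ladder_atS n I J T T' : T' \subset T ->
  ladder_at n I J T' -> ladder_at n I J T.
Proof.
move=> /subsetP sT [p [q [y [? ? yT ? ?]]]]; exists p, q, y; split=> //.
by move=> i /yT/sT.
Qed.

Lemma ladder_at_cat n I J T s : ladder_at n I J T -> ladder_at n (I ++ s) J T.
Proof.
move=> [p [q [y [[s' ->] ? ? ? ?]]]]; exists p, q, y; split=> //.
by exists (s' ++ s); rewrite catA.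
Qed.

Lemma mkseqSl (U : Type) (f : nat -> U) n :
  mkseq f n.+1 = f 0 :: mkseq (f \o S) n.
Proof. by rewrite /mkseq /= (iotaDl 1 0) -map_comp. Qed.

Lemma flatten_sub (U : eqType) (f : nat -> seq U) n j : j < n ->
  {subset f j <= flatten (mkseq f n)}.
Proof.
move=> jn x xf; apply/flattenP; exists (f j) => //.
by apply/mapP; exists j => //; rewrite mem_iota.
Qed.

Lemma touchs_sub t s s' : {subset s' <= s} -> touchs t s' -> touchs t s.
Proof. by move=> ss /hasP[x /ss xs tx]; apply/hasP; exists x. Qed.

(** The new prefix touches no letter of T, so the first chunk can absorb it and the chunks still
    begin at the head of the word. *)
Lemma ladder_at_extend n I1 z I2 J T :
  {in T, forall t, ~~ touchs t (rcons I1 z)} ->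
  ladder_at n I2 J T -> ladder_at n (I1 ++ z :: I2) J T.
Proof.
move=> TI [p [q [y [[s ->] [s' ->] yT yp yq]]]].
case: n => [|n] in yT yp yq *.
  exists p, q, y; split=> //; first by exists (I1 ++ z :: s).
  by exists s'.
pose p' i := if i is 0 then I1 ++ z :: p 0 else p i.
exists p', q, y; split=> //; last 1 first.
- move=> i [|j] ni nj; last by rewrite yp.
  rewrite -yp // /p' -cat_rcons touchs_cat (negbTE (TI _ (yT _ ni))) //.
- by exists s; rewrite !mkseqSl /= -!catA.
- by exists s'.
Qed.

(** The two prefixes become the first chunks and y the first rung: y does not occur after them, and
    no later rung occurs in them. *)
Lemma ladder_at_cons n I1 z I2 J1 w J2 y T T' :
  y \in T -> T' \subset T ->
  touchs y (rcons I1 z) -> ~~ touchs y I2 ->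
  touchs y (rcons J1 w) -> ~~ touchs y J2 ->
  {in T', forall t, ~~ touchs t (rcons I1 z)} ->
  {in T', forall t, ~~ touchs t (rcons J1 w)} ->
  ladder_at n I2 J2 T' -> ladder_at n.+1 (I1 ++ z :: I2) (J1 ++ w :: J2) T.
Proof.
move=> yT /subsetP sT yI1 yI2 yJ1 yJ2 TI TJ [p [q [r [[s Is] [s' Js] rT rp rq]]]].
pose cons_fun (U : Type) (u : U) f i := if i is i'.+1 then f i' else u.
exists (cons_fun _ (rcons I1 z) p), (cons_fun _ (rcons J1 w) q), (cons_fun _ y r).
split.
- by exists s; rewrite mkseqSl /= -catA cat_rcons Is.
- by exists s'; rewrite mkseqSl /= -catA cat_rcons Js.
- by case=> //= i ni; apply/sT/rT.
- move=> [|i] [|j] //= ni nj.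
  + apply: contraNF yI2; apply: touchs_sub => x /(flatten_sub (nj : j < n)) xp.
    by rewrite Is mem_cat xp.
  + by apply/negbTE/TI/rT.
  + by rewrite rp.
- move=> [|i] [|j] //= ni nj.
  + apply: contraNF yJ2; apply: touchs_sub => x /(flatten_sub (nj : j < n)) xp.
    by rewrite Js mem_cat xp.
  + by apply/negbTE/TJ/rT.
  + by rewrite rq.
Qed.

End Words.


(** * Induced paths, and single moves on two or three separated words *)

Section Paths.
Variable G : sgraph.
Implicit Types (T : {set G}) (s I J U : seq G) (t x y z w : G).

Definition ipath s := uniq s /\
  {in s &, forall x y, edge x y =
    ((index x s).+1 == index y s) || ((index y s).+1 == index x s)}.

Definition sep s1 s2 := {in s1 & s2, forall x y, (x != y) && ~~ edge x y}.

Lemma sepC s1 s2 : sep s1 s2 -> sep s2 s1.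
Proof. by move=> H x y xs ys; rewrite eq_sym edge_sym H. Qed.

Lemma sepS s1 s2 s1' s2' : {subset s1' <= s1} -> {subset s2' <= s2} ->
  sep s1 s2 -> sep s1' s2'.
Proof. by move=> h1 h2 H x y /h1 xs /h2 ys; apply: H. Qed.

Lemma ipath_cat s1 s2 : ipath (s1 ++ s2) -> ipath s1 /\ ipath s2.
Proof.
case; rewrite cat_uniq => /and3P[u1 /hasPn d u2] E; split; split=> // x y xs ys.
  by rewrite E ?mem_cat ?xs ?ys // !index_cat xs ys.
rewrite E ?mem_cat ?xs ?ys ?orbT // !index_cat (negbTE (d _ xs)) (negbTE (d _ ys)).
by rewrite -!addnS !eqn_add2l.
Qed.

Lemma ipath_cut s1 z s2 : ipath (s1 ++ z :: s2) -> sep s1 s2.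
Proof.
case; rewrite cat_uniq => /and3P[u1 /hasPn d /= /andP[zs u2]] E x y xs ys.
have ys1 : y \notin s1 by apply: d; rewrite inE ys orbT.
have yz : y != z by apply: contraNneq zs => <-.
apply/andP; split; first by apply: contraNneq ys1 => <-.
rewrite E ?mem_cat ?xs ?inE ?ys ?orbT // !index_cat xs (negbTE ys1) /=.
rewrite [z == y]eq_sym (negbTE yz) /=; move: xs; rewrite -index_mem => xs.
by move: (index x s1) (index y s2) (size s1) xs => i j n; lia.
Qed.

Lemma ipath_link s1 x y s2 : ipath (rcons s1 x ++ y :: s2) -> edge x y.
Proof.
case=> U E; have [xs ys] : x \in rcons s1 x ++ y :: s2 /\ y \in rcons s1 x ++ y :: s2.
  by rewrite !mem_cat mem_rcons !inE !eqxx orbT.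
rewrite E //; move: U; rewrite cat_uniq => /and3P[u1 /hasPn d _].
have ys1 : y \notin rcons s1 x by apply: d; rewrite inE eqxx.
have xs1 : x \notin s1 by move: u1; rewrite rcons_uniq => /andP[].
rewrite !index_cat mem_rcons inE eqxx /= (negbTE ys1) /= eqxx addn0 size_rcons.
by rewrite -cats1 index_cat (negbTE xs1) /= eqxx addn0 eqxx.
Qed.

Lemma ipath_rev s : ipath s -> ipath (rev s).
Proof.
have rev_index x : uniq s -> x \in s -> index x (rev s) = size s - (index x s).+1.
  move=> U xs; have i_s : index x s < size s by rewrite index_mem.
  have r_s : size s - (index x s).+1 < size s.
    by move: (index x s) (size s) i_s => i n; lia.
  have {1}<- : nth x (rev s) (size s - (index x s).+1) = x.
    rewrite nth_rev // -[RHS](nth_index x xs); congr nth.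
    by move: (index x s) (size s) i_s => i n; lia.
  by rewrite index_uniq ?rev_uniq ?size_rev.
case=> U E; split=> [|x y]; first by rewrite rev_uniq.
rewrite !mem_rev => xs ys; rewrite E // !rev_index //.
move: xs ys; rewrite -!index_mem.
by move: (index x s) (index y s) (size s) => i j n; lia.
Qed.

Lemma ipath_connected s x : ipath s -> x \in s -> connected_in [set y in s].
Proof.
elim: s x => // y s IHs x ips _; case: s IHs ips => [_ _|z s IHs ips].
  by rewrite set_seq1; apply: connected1.
have yz := @ipath_link [::] y z s ips.
have [_ ips'] := @ipath_cat [:: y] _ ips.
have cs := IHs z ips' (mem_head _ _).
rewrite (_ : [set _ in _] = y |: [set u in z :: s]); last by apply/setP=> u; rewrite !inE.
by apply: connected_add cs _; apply/touchP; exists z; rewrite ?inE ?eqxx.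
Qed.

Lemma touch_set t s : touch t [set x in s] = touchs t s.
Proof.
by apply/touchP/hasP => -[x xs tx]; exists x => //; rewrite inE in xs *.
Qed.

(** Separated connections between t and t' inside U; k of them yield a k-creature by [pieces_false].
    Indexing by [nat] makes it easy to put a new piece in front. *)
Definition pieces p U t t' := exists w : nat -> {set G},
  (forall i, i < p -> [/\ connected_in (w i), {in w i, forall x, x \in U},
      touch t (w i) & touch t' (w i)]) /\
  (forall i j, i < p -> j < p -> i != j ->
      {in w i & w j, forall x y, (x != y) && ~~ edge x y}).

Lemma pieces_sub p U U' t t' : {subset U <= U'} ->
  pieces p U t t' -> pieces p U' t t'.
Proof.
move=> sU [w [wP wS]]; exists w; split=> // i /wP[? wU ? ?]; split=> // x /wU.
exact: sU.
Qed.

Lemma pieces_cons p U s t t' : ipath s -> sep U s -> touchs t s ->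
  touchs t' s -> pieces p U t t' -> pieces p.+1 (U ++ s) t t'.
Proof.
move=> ips Us ts t's [w [wP wS]].
exists (fun i => if i is i'.+1 then w i' else [set x in s]); split.
  case=> [_|i ni] /=; last first.
    by have [? wU ? ?] := wP i ni; split=> // x /wU; rewrite mem_cat => ->.
  have /hasP[x xs _] := ts.
  split; rewrite ?touch_set //; first exact: ipath_connected xs.
  by move=> y; rewrite inE mem_cat orbC => ->.
move=> [|i] [|j] //= ni nj ij x y; rewrite ?inE.
- move=> xs yw; apply: sepC xs _; first exact: Us.
  by have [_ wU _ _] := wP j nj; apply: wU.
- move=> xw ys; apply: Us ys.
  by have [_ wU _ _] := wP i ni; apply: wU.
- exact: wS.
Qed.

Definition word T s := [/\ ipath s, single_touch T s & all_touch T s].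

Lemma wordS T T' s : T' \subset T -> word T s -> word T' s.
Proof.
move=> sT [? h1 h2]; split=> //; first exact: single_touchS h1.
exact: all_touchS h2.
Qed.

Lemma sub_cut_l s1 z s2 : {subset s1 <= s1 ++ z :: s2}.
Proof. by move=> x xs; rewrite mem_cat xs. Qed.
Lemma sub_cut_r s1 z s2 : {subset s2 <= s1 ++ z :: s2}.
Proof. by move=> x xs; rewrite mem_cat inE xs !orbT. Qed.

Lemma word_right T s1 z s2 : word T (s1 ++ z :: s2) ->
  word (right_of T s1 z) s2.
Proof.
case=> ips T1 Ta; split; last exact: right_of_touch Ta.
  have [_ ] := ipath_cat ips; rewrite -cat1s => ips'.
  by have [] := ipath_cat ips'.
by apply: single_touchS T1; [exact: right_ofS|exact: sub_cut_r].
Qed.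

Lemma word_both T s1 z s2 : word T (s1 ++ z :: s2) ->
  word (both_of T s1 s2) s1 /\ word (both_of T s1 s2) s2.
Proof.
case=> ips T1 Ta; have [ips1 ips2] := ipath_cat ips.
rewrite -cat1s in ips2; have [_ {}ips2] := ipath_cat ips2.
split; split=> //.
- by apply: single_touchS T1; [exact: both_ofS|exact: sub_cut_l].
- by move=> t; rewrite inE => /and3P[].
- by apply: single_touchS T1; [exact: both_ofS|exact: sub_cut_r].
- by move=> t; rewrite inE => /and3P[].
Qed.

(** Each pair of words has its own target number of rungs, and p is the target number of pieces.
    Every move lowers one target by one, so a + b + c + p measures the induction of
    [three_words]. *)
Definition outcome a b c p s1 s2 s3 T :=
  [\/ ladder_at a s1 s2 T, ladder_at b s1 s3 T, ladder_at c s2 s3 T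
    | exists t t', [/\ t \in T, t' \in T, t != t'
        & pieces p (s1 ++ s2 ++ s3) t t']].

Lemma outcome_swap12 a b c p s1 s2 s3 T :
  outcome a b c p s1 s2 s3 T -> outcome a c b p s2 s1 s3 T.
Proof.
case=> [/ladder_atC|||[t [t' [tT t'T tt P]]]]; [by constructor 1|by constructor 3|by constructor 2|].
constructor 4; exists t, t'; split=> //; apply: pieces_sub P => x.
by rewrite !mem_cat orbCA.
Qed.

Lemma outcome_swap23 a b c p s1 s2 s3 T :
  outcome a b c p s1 s2 s3 T -> outcome b a c p s1 s3 s2 T.
Proof.
case=> [||/ladder_atC|[t [t' [tT t'T tt P]]]]; [by constructor 2|by constructor 1|by constructor 3|].
constructor 4; exists t, t'; split=> //; apply: pieces_sub P => x.
by rewrite !mem_cat [(x \in s2) || _]orbC.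
Qed.

Definition words3 T s1 s2 s3 :=
  [/\ word T s1, word T s2 & word T s3] /\ [/\ sep s1 s2, sep s1 s3 & sep s2 s3].

Lemma words3_swap12 T s1 s2 s3 : words3 T s1 s2 s3 -> words3 T s2 s1 s3.
Proof. by case=> -[? ? ?] [/sepC ? ? ?]. Qed.

Lemma words3_swap23 T s1 s2 s3 : words3 T s1 s2 s3 -> words3 T s1 s3 s2.
Proof. by case=> -[? ? ?] [? ? /sepC ?]. Qed.

Lemma words3S T T' s1 s2 s3 : T' \subset T -> words3 T s1 s2 s3 -> words3 T' s1 s2 s3.
Proof. by move=> sT [[? ? ?] ?]; split=> //; split; apply: wordS sT _. Qed.

Lemma words3_both T I1 z I2 s2 s3 : words3 T (I1 ++ z :: I2) s2 s3 ->
  words3 (both_of T I1 I2) I1 s2 s3.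
Proof.
move=> [[w1 w2 w3] [S12 S13 S23]]; have [wx _] := word_both w1.
split; split=> //; try exact: wordS (both_ofS _ _ _) _.
  by apply: sepS S12 => //; apply: sub_cut_l.
by apply: sepS S13 => //; apply: sub_cut_l.
Qed.

(** All letters of [both_of] touch I2, so I2 is a piece for whichever two letters are found in the
    end. The search goes on in I1, which z separates from I2. *)
Lemma outcome_both a b c p I1 z I2 s2 s3 T : words3 T (I1 ++ z :: I2) s2 s3 ->
  outcome a b c p I1 s2 s3 (both_of T I1 I2) ->
  outcome a b c p.+1 (I1 ++ z :: I2) s2 s3 T.
Proof.
move=> [[w1 w2 w3] [S12 S13 S23]]; have [wx1 wx2] := word_both w1.
case=> [L|L|L|[t [t' [tB t'B tt P]]]].
- constructor 1; apply: ladder_at_cat; apply: ladder_atS (both_ofS _ _ _) L.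
- constructor 2; apply: ladder_at_cat; apply: ladder_atS (both_ofS _ _ _) L.
- constructor 3; apply: ladder_atS (both_ofS _ _ _) L.
constructor 4; exists t, t'; split=> //;
  try exact: (subsetP (both_ofS _ _ _) _ tB);
  try exact: (subsetP (both_ofS _ _ _) _ t'B).
have [ips _ ax2] := wx2.
have : pieces p.+1 ((I1 ++ s2 ++ s3) ++ I2) t t'.
  apply: pieces_cons P; rewrite ?ax2 //.
  move=> x y; rewrite !mem_cat => /or3P[xs|xs|xs] ys.
  - by case: w1 => /ipath_cut S _ _; apply: S.
  - by apply: (sepC S12) => //; apply: sub_cut_r.
  - by apply: (sepC S13) => //; apply: sub_cut_r.
move=> P'; apply: pieces_sub P' => x; rewrite !(mem_cat, inE) -!orbA.
by case: (x \in I1) (x \in I2) (x \in s2) (x \in s3) => [] [] [] []; rewrite ?orbT.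
Qed.

Lemma words3_progress T T' I1 z I2 J1 w J2 s3 :
  words3 T (I1 ++ z :: I2) (J1 ++ w :: J2) s3 ->
  T' \subset right_of T I1 z -> T' \subset right_of T J1 w ->
  words3 T' I2 J2 s3.
Proof.
move=> [[w1 w2 w3] [S12 S13 S23]] sx su; split; split.
- exact: wordS sx (word_right w1).
- exact: wordS su (word_right w2).
- exact: wordS (subset_trans sx (right_ofS _ _ _)) w3.
- by apply: sepS S12 => //; apply: sub_cut_r.
- by apply: sepS S13 => //; apply: sub_cut_r.
- by apply: sepS S23 => //; apply: sub_cut_r.
Qed.

Lemma ladder_at_progress n T T' I1 z I2 J1 w J2 y :
  word T (I1 ++ z :: I2) -> word T (J1 ++ w :: J2) ->
  y \in left_of T z I2 -> y \in left_of T w J2 ->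
  T' \subset right_of T I1 z -> T' \subset right_of T J1 w ->
  ladder_at n I2 J2 T' -> ladder_at n.+1 (I1 ++ z :: I2) (J1 ++ w :: J2) T.
Proof.
move=> [_ _ ax] [_ _ au] yx yu sx su.
have right_no s0 v T1 : T1 \subset right_of T s0 v ->
    {in T1, forall t, ~~ touchs t (rcons s0 v)}.
  by move=> /subsetP sT t /sT; rewrite inE => /andP[].
apply: (ladder_at_cons (y := y)).
- exact: subsetP (left_ofS _ _ _) _ yx.
- exact: subset_trans sx (right_ofS _ _ _).
- by rewrite touchs_rcons (left_of_touch ax yx).
- by move: yx; rewrite inE touchs_cons negb_or => /and3P[].
- by rewrite touchs_rcons (left_of_touch au yu).
- by move: yu; rewrite inE touchs_cons negb_or => /and3P[].
- exact: right_no.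
- exact: right_no.
Qed.

(** In both words y comes before all of T', so it is a new first rung for this pair. Ladders of the
    other pairs survive, since the discarded prefixes touch no letter of T'. *)
Lemma outcome_progress a b c p T T' I1 z I2 J1 w J2 s3 y :
  words3 T (I1 ++ z :: I2) (J1 ++ w :: J2) s3 ->
  y \in left_of T z I2 -> y \in left_of T w J2 ->
  T' \subset right_of T I1 z -> T' \subset right_of T J1 w ->
  outcome a b c p I2 J2 s3 T' ->
  outcome a.+1 b c p (I1 ++ z :: I2) (J1 ++ w :: J2) s3 T.
Proof.
move=> [[w1 w2 w3] _] yx yu sx su.
have sT := subset_trans sx (right_ofS _ _ _).
have right_no s0 v T1 : T1 \subset right_of T s0 v ->
    {in T1, forall t, ~~ touchs t (rcons s0 v)}.
  by move=> /subsetP sT' t /sT'; rewrite inE => /andP[].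
case=> [L|L|L|[t [t' [tT t'T tt P]]]].
- by constructor 1; apply: ladder_at_progress yx yu sx su L.
- by constructor 2; apply: ladder_atS sT _; apply: ladder_at_extend (right_no _ _ _ sx) L.
- by constructor 3; apply: ladder_atS sT _; apply: ladder_at_extend (right_no _ _ _ su) L.
constructor 4; exists t, t'; split=> //;
  try exact: (subsetP sT _ tT); try exact: (subsetP sT _ t'T).
apply: pieces_sub P => x; rewrite !(mem_cat, inE) => /or3P[]->; by rewrite ?orbT.
Qed.

End Paths.


(** * Ladders or pieces from many common letters *)

Section WordLadders.
Variable G : sgraph.
Implicit Types (T : {set G}) (s I J : seq G) (t y z w : G).

Lemma card1_ex (T : {set G}) : #|T| = 1 -> exists y, y \in T.
Proof. by move=> T1; apply/card_gt0P; rewrite T1. Qed.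

(* Cutting [s1] splits the letters into early and late ones.  If [s2] or [s3]
   can be cut compatibly, that pair of words gains a rung; otherwise both reverse
   the order of [s1], hence agree with each other. *)
Lemma three_words n a b c p s1 s2 s3 T : a + b + c + p = n ->
  words3 T s1 s2 s3 -> 16 ^ n <= #|T| -> outcome a b c p s1 s2 s3 T.
Proof.
elim: n a b c p s1 s2 s3 T => [|n IHn] a b c p s1 s2 s3 T abcp W sizeT.
  have [a0 _] : a = 0 /\ true by lia.
  by constructor 1; rewrite a0; apply: ladder_at0; lia.
have T_gt0 : #|T| > 0 by apply: leq_trans sizeT; rewrite expn_gt0.
case: a abcp => [|a] abcp; first by constructor 1; apply: ladder_at0.
case: b abcp => [|b] abcp; first by constructor 2; apply: ladder_at0.
case: c abcp => [|c] abcp; first by constructor 3; apply: ladder_at0.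
have [M_gt0 sizeT' {sizeT}] : 0 < 16 ^ n /\ 16 * 16 ^ n <= #|T|.
  by rewrite expn_gt0 -expnS.
case: p abcp => [|p] abcp.
  have /card_gt1P[t [t' [tT t'T tt]]] : 1 < #|T| by lia.
  by constructor 4; exists t, t'; split=> //; exists (fun=> set0).
have IH : forall a' b' c' p' r1 r2 r3 (T' : {set G}), a' + b' + c' + p' = n ->
    words3 T' r1 r2 r3 -> 16 ^ n <= #|T'| -> outcome a' b' c' p' r1 r2 r3 T'.
  by move=> *; apply: IHn.
move: (16 ^ n) M_gt0 sizeT' IH => M M_gt0 sizeT IH {IHn}.
have small1 a' b' c' r1 z r2 r3 r4 (T' : {set G}) : a' + b' + c' + p = n ->
    words3 T' (r1 ++ z :: r2) r3 r4 -> M <= #|both_of T' r1 r2| ->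
    outcome a' b' c' p.+1 (r1 ++ z :: r2) r3 r4 T'.
  move=> E W' big; apply: (outcome_both W'); apply: IH => //.
  exact: words3_both W'.
have outS a' b' c' p' r1 r2 r3 (T' : {set G}) : T' \subset T ->
    outcome a' b' c' p' r1 r2 r3 T' -> outcome a' b' c' p' r1 r2 r3 T.
  move=> sT [L|L|L|[t [t' [/(subsetP sT) tT /(subsetP sT) t'T tt P]]]].
  - by constructor 1; apply: ladder_atS L.
  - by constructor 2; apply: ladder_atS L.
  - by constructor 3; apply: ladder_atS L.
  - by constructor 4; exists t, t'.
have [[[_ T1 Ta] [_ U1 Ua] [_ V1 Va]] _] := W.
(* Each of the two later cuts costs the early letters one on its left, at most one at its vertex and
   fewer than M on both sides; [3 * M + 2] leaves M of them. *)
have [|I1 [z [I2 [E1 cardL]]]] := cut_at T1 Ta (c := 3 * M + 2).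
  by move: sizeT M_gt0; clear; lia.
rewrite {}E1 in W T1 Ta *.
set L := left_of T z I2 in cardL; set R := right_of T I1 z.
have sLT : L \subset T by apply: left_ofS.
have sRT : R \subset T by apply: right_ofS.
have [big|smallT] := leqP M #|both_of T I1 I2|.
  by apply: small1 => //; move: abcp; clear; lia.
have cardT := cut_card T1; rewrite -/L -/R in cardT.
have single2 T' : T' \subset T -> single_touch T' s2 by move=> sT; apply: single_touchS U1.
have all2 T' : T' \subset T -> all_touch T' s2 by move=> sT; apply: all_touchS Ua.
have [|J1 [w [J2 [E2 cardLL]]]] := cut_at (single2 L sLT) (all2 L sLT) (c := 1).
  by rewrite cardL; clear; lia.
rewrite {}E2 in W U1 Ua single2 all2 *.
have small2 (T' : {set G}) : T' \subset T -> M <= #|both_of T' J1 J2| ->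
    outcome a.+1 b.+1 c.+1 p.+1 (I1 ++ z :: I2) (J1 ++ w :: J2) s3 T.
  move=> sT big; apply: (outS _ _ _ _ _ _ _ T') => //; apply: outcome_swap12.
  apply: small1 big; first by move: abcp; clear; lia.
  by apply: words3_swap12; apply: words3S W.
have [/(small2 _ sLT) //|smallL] := leqP M #|both_of L J1 J2|.
have [/(small2 _ sRT) //|smallR] := leqP M #|both_of R J1 J2|.
have cardLT := cut_card (single2 _ sLT); have cardRT := cut_card (single2 _ sRT).
(* In names such as [LR] or [RLL], the i-th character tells on which side of the cut of the i-th
   word these letters lie. *)
set LR := right_of L J1 w in cardLT; set RR := right_of R J1 w in cardRT.
set RL := left_of R w J2 in cardRT.
have sLR : LR \subset right_of T J1 w.
  by apply/subsetP => t; rewrite !inE => /andP[/andP[-> _]].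
have sRR : RR \subset right_of T J1 w.
  by apply/subsetP => t; rewrite !inE => /andP[/andP[-> _]].
have sRL : RL \subset left_of T w J2.
  by apply/subsetP => t; rewrite !inE => /andP[/andP[-> _]].
have [bigRR|smallRR] := leqP M #|RR|.
  have [y] := card1_ex cardLL; rewrite inE => /andP[yL yw].
  apply: (@outcome_progress _ _ _ _ _ T RR _ _ _ _ _ _ _ y W yL) => //.
  - by rewrite inE (subsetP sLT).
  - exact: right_ofS.
  - apply: IH => //; first by move: abcp; clear; lia.
    by apply: words3_progress W _ sRR; apply: right_ofS.
have sLRT : LR \subset T by apply: subset_trans (right_ofS _ _ _) sLT.
have sRLT : RL \subset T by apply: subset_trans (left_ofS _ _ _) sRT.
have single3 T' : T' \subset T -> single_touch T' s3 by move=> sT; apply: single_touchS V1.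
have all3 T' : T' \subset T -> all_touch T' s3 by move=> sT; apply: all_touchS Va.
have [|K1 [r [K2 [E3 cardLRL]]]] := cut_at (single3 LR sLRT) (all3 LR sLRT) (c := 1).
  by move: smallL cardLT; rewrite cardL cardLL -/LR; move: M_gt0; clear; lia.
rewrite {}E3 in W V1 Va single3 all3 *.
have small3 (T' : {set G}) : T' \subset T -> M <= #|both_of T' K1 K2| ->
    outcome a.+1 b.+1 c.+1 p.+1 (I1 ++ z :: I2) (J1 ++ w :: J2) (K1 ++ r :: K2) T.
  move=> sT big; apply: (outS _ _ _ _ _ _ _ T') => //.
  apply: outcome_swap23; apply: outcome_swap12.
  apply: small1 big; first by move: abcp; clear; lia.
  by apply: words3_swap12; apply: words3_swap23; apply: words3S W.
have [/(small3 _ sLRT) //|smallLR] := leqP M #|both_of LR K1 K2|.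
have [/(small3 _ sRLT) //|smallRL] := leqP M #|both_of RL K1 K2|.
have cardLRT := cut_card (single3 _ sLRT); have cardRLT := cut_card (single3 _ sRLT).
set LRR := right_of LR K1 r in cardLRT; set RLR := right_of RL K1 r in cardRLT.
set RLL := left_of RL r K2 in cardRLT.
have sLRR : LRR \subset right_of T K1 r.
  by apply/subsetP => t; rewrite !inE => /andP[/andP[/andP[-> _] _]].
have sRLR : RLR \subset right_of T K1 r.
  by apply/subsetP => t; rewrite !inE => /andP[/andP[/andP[-> _] _]].
have [bigRLR|smallRLR] := leqP M #|RLR|.
  have [y] := card1_ex cardLRL; rewrite inE => /andP[yLR yr].
  have yL : y \in L by apply: (subsetP (right_ofS _ _ _)) yLR.
  apply: outcome_swap23.
  apply: (@outcome_progress _ _ _ _ _ T RLR _ _ _ _ _ _ _ y (words3_swap23 W) yL) => //.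
  - by rewrite inE (subsetP sLT).
  - exact: subset_trans (right_ofS _ _ _) (left_ofS _ _ _).
  - apply: IH => //; first by move: abcp; clear; lia.
    apply: words3_progress (words3_swap23 W) _ sRLR.
    exact: subset_trans (right_ofS _ _ _) (left_ofS _ _ _).
(* One letter late in s1 but early in s2 and s3 suffices: it is the rung placed before [LRR], the
   letters early in s1 and late in the other two. *)
have [y yRLL] : exists y, y \in RLL.
  apply/card_gt0P.
  move: smallRLR smallRL smallRR smallR smallT cardT cardRT cardRLT sizeT cardL.
  by rewrite -/LR -/RR -/RL -/RLR -/RLL; clear; lia.
have [yw yr] : y \in left_of T w J2 /\ y \in left_of T r K2.
  move: (yRLL); rewrite !inE => /andP[/andP[/andP[-> _] ->] ->]; by [].
apply: outcome_swap12; apply: outcome_swap23.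
have W' := words3_swap23 (words3_swap12 W).
apply: (@outcome_progress _ _ _ _ _ T LRR _ _ _ _ _ _ _ y W' yw yr) => //.
- exact: subset_trans (right_ofS _ _ _) sLR.
- apply: IH => //; first by move: abcp; clear; lia.
  2: by move: smallLR smallL cardLT cardLRT cardL cardLL cardLRL;
     rewrite -/LR -/LRR; clear; lia.
  apply: words3_progress W' _ sLRR.
  exact: subset_trans (right_ofS _ _ _) sLR.
Qed.

Definition three_paths m I J T := exists (s1 s2 s3 : seq G) (T' : {set G}),
  [/\ T' \subset T, words3 T' s1 s2 s3, m <= #|T'|
    & {subset s1 ++ s2 ++ s3 <= I ++ J}].

Definition outcome2 m l r I J T :=
  [\/ ladder_at l I J T, ladder_at r I (rev J) T | three_paths m I J T].

Lemma word_rev T s : word T s -> word T (rev s).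
Proof.
case=> ips T1 Ta; split; first exact: ipath_rev.
  by apply: single_touchS T1 => // x; rewrite mem_rev.
by move=> t /Ta; rewrite touchs_rev.
Qed.

Lemma rev_cut s1 z s2 : rev (s1 ++ z :: s2) = rev s2 ++ z :: rev s1.
Proof. by rewrite rev_cat rev_cons cat_rcons. Qed.

Lemma left_of_rev T z s : left_of T z (rev s) = right_of T s z.
Proof.
by apply/setP => t; rewrite !inE touchs_cons touchs_rev touchs_rcons orbC.
Qed.

Lemma right_of_rev T z s : right_of T (rev s) z = left_of T z s.
Proof.
by apply/setP => t; rewrite !inE touchs_cons touchs_rcons touchs_rev orbC.
Qed.

Lemma three_pathsS m I J I' J' T T' : T' \subset T ->
  {subset I' <= I} -> {subset J' <= J} ->
  three_paths m I' J' T' -> three_paths m I J T.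
Proof.
move=> sT sI sJ [s1 [s2 [s3 [T1 [sT1 W mT sub]]]]].
exists s1, s2, s3, T1; split=> //; first exact: subset_trans sT.
by move=> x /sub; rewrite !mem_cat => /orP[/sI|/sJ] ->; rewrite ?orbT.
Qed.

Lemma three_paths_bothl m I1 z I2 J T :
  word T (I1 ++ z :: I2) -> word T J -> sep (I1 ++ z :: I2) J ->
  m <= #|both_of T I1 I2| -> three_paths m (I1 ++ z :: I2) J T.
Proof.
move=> wI wJ S big; have [w1 w2] := word_both wI.
exists I1, I2, J, (both_of T I1 I2); split=> //; first exact: both_ofS.
  split; split=> //; first exact: wordS (both_ofS _ _ _) _.
  - by case: wI => /ipath_cut.
  - by apply: sepS S => //; apply: sub_cut_l.
  - by apply: sepS S => //; apply: sub_cut_r.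
move=> x; rewrite !(mem_cat, inE) => /or3P[]->; by rewrite ?orbT.
Qed.

Lemma three_pathsC m I J T : three_paths m I J T -> three_paths m J I T.
Proof.
move=> [s1 [s2 [s3 [T1 [sT1 W mT sub]]]]]; exists s1, s2, s3, T1; split=> //.
by move=> x /sub; rewrite !mem_cat orbC.
Qed.

(* When the early and late letters of [I] are reversed in [J], they agree in
   [rev J]; when many letters occur on both sides of a cut, the two sides and the
   other path are three paths to which [three_words] applies. *)
Lemma two_words m n l r I J T : l + r = n -> 0 < m ->
  word T I -> word T J -> sep I J -> 16 ^ n * m <= #|T| ->
  outcome2 m l r I J T.
Proof.
move=> + m_gt0; elim: n l r I J T => [|n IHn] l r I J T lr wI wJ S sizeT.
  have [l0 _] : l = 0 /\ true by lia.
  by constructor 1; rewrite l0; apply: ladder_at0; lia.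
have T_gt0 : #|T| > 0 by apply: leq_trans sizeT; rewrite muln_gt0 expn_gt0.
case: l lr => [|l] lr; first by constructor 1; apply: ladder_at0.
case: r lr => [|r] lr; first by constructor 2; apply: ladder_at0.
have [M_gt0 {}sizeT] : m <= 16 ^ n * m /\ 16 * (16 ^ n * m) <= #|T|.
  by rewrite mulnA -expnS leq_pmull // expn_gt0.
have IH : forall l' r' I' J' (T' : {set G}), l' + r' = n ->
    word T' I' -> word T' J' -> sep I' J' -> 16 ^ n * m <= #|T'| ->
    outcome2 m l' r' I' J' T'.
  by move=> *; apply: IHn.
move: (16 ^ n * m) M_gt0 sizeT IH => M M_gt0 sizeT IH {IHn}.
have [_ T1 Ta] := wI; have [_ U1 Ua] := wJ.
(* The cut of J costs these letters one on its left, at most one at its vertex and fewer than m on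
   both sides; at least one remains on its right, the rung needed for [rev J]. *)
have [|I1 [z [I2 [E1 cardL]]]] := cut_at T1 Ta (c := m + 2).
  by move: sizeT M_gt0 m_gt0; clear; lia.
rewrite {}E1 in wI T1 Ta S *.
set L := left_of T z I2 in cardL; set R := right_of T I1 z.
have sLT : L \subset T by apply: left_ofS.
have sRT : R \subset T by apply: right_ofS.
have [big|smallT] := leqP m #|both_of T I1 I2|.
  by constructor 3; apply: three_paths_bothl.
have cardT := cut_card T1; rewrite -/L -/R in cardT.
have single2 T' : T' \subset T -> single_touch T' J by move=> sT; apply: single_touchS U1.
have all2 T' : T' \subset T -> all_touch T' J by move=> sT; apply: all_touchS Ua.
have [|J1 [w [J2 [E2 cardLL]]]] := cut_at (single2 L sLT) (all2 L sLT) (c := 1); first by lia.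
rewrite {}E2 in wJ U1 Ua S single2 all2 *.
have small2 (T' : {set G}) : T' \subset T -> m <= #|both_of T' J1 J2| ->
    outcome2 m l.+1 r.+1 (I1 ++ z :: I2) (J1 ++ w :: J2) T.
  move=> sT big; constructor 3.
  apply: (@three_pathsS _ (I1 ++ z :: I2) (J1 ++ w :: J2)
    (I1 ++ z :: I2) (J1 ++ w :: J2) _ _ sT) => //.
  apply: three_pathsC; apply: three_paths_bothl big.
  - exact: wordS sT wJ.
  - exact: wordS sT wI.
  - exact: sepC.
have [/(small2 _ sLT) //|smallL] := leqP m #|both_of L J1 J2|.
have [/(small2 _ sRT) //|smallR] := leqP m #|both_of R J1 J2|.
have cardLT := cut_card (single2 _ sLT); have cardRT := cut_card (single2 _ sRT).
set LR := right_of L J1 w in cardLT; set RR := right_of R J1 w in cardRT.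
set RL := left_of R w J2 in cardRT.
have sRR : RR \subset right_of T J1 w.
  by apply/subsetP => t; rewrite !inE => /andP[/andP[-> _]].
have sRL : RL \subset left_of T w J2.
  by apply/subsetP => t; rewrite !inE => /andP[/andP[-> _]].
have right_no s0 v T' : T' \subset right_of T s0 v ->
    {in T', forall t, ~~ touchs t (rcons s0 v)}.
  by move=> /subsetP sT' t /sT'; rewrite inE => /andP[].
have wR : word R I2 by apply: word_right.
have [bigRR|smallRR] := leqP M #|RR|.
  have [y] := card1_ex cardLL; rewrite inE => /andP[yL yw].
  have yJ : y \in left_of T w J2 by rewrite inE (subsetP sLT).
  have sRRR : RR \subset R by apply: right_ofS.
  have sRRT := subset_trans sRRR sRT.
  case: (IH l r.+1 I2 J2 RR) => [||||//|Ld|Ld|P3].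
  - by move: lr; clear; lia.
  - exact: wordS wR.
  - exact: wordS (word_right wJ).
  - by apply: sepS S; apply: sub_cut_r.
  - by constructor 1; apply: ladder_at_progress yL yJ sRRR sRR Ld.
  - constructor 2; apply: ladder_atS sRRT _; apply: ladder_at_extend (right_no _ _ _ sRRR) _.
    by rewrite rev_cut; apply/ladder_atC/ladder_at_cat/ladder_atC.
  - by constructor 3; apply: three_pathsS P3 => //; apply: sub_cut_r.
have [y] : exists y, y \in LR.
  apply/card_gt0P.
  by move: smallL cardLT cardLL cardL; rewrite -/LR; clear; lia.
rewrite inE => /andP[yL yw].
have yJ : y \in left_of T w (rev J1) by rewrite left_of_rev inE (subsetP sLT).
have sRLR : RL \subset R by apply: left_ofS.
have sRLT := subset_trans sRLR sRT.
have bigRL : M <= #|RL|.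
  move: smallRR smallR smallT cardT cardRT sizeT cardL M_gt0.
  by rewrite -/RL -/RR; clear; lia.
have wJ' := word_rev wJ; rewrite rev_cut in wJ'.
have sRL' : RL \subset right_of T (rev J2) w by rewrite right_of_rev.
case: (IH l.+1 r I2 J1 RL) => [||||//|Ld|Ld|P3].
- by move: lr; clear; lia.
- exact: wordS wR.
- have := word_rev (word_right wJ'); rewrite revK; exact: wordS.
- by apply: sepS S; [apply: sub_cut_r|apply: sub_cut_l].
- constructor 1; apply: ladder_atS sRLT _; apply: ladder_at_extend (right_no _ _ _ sRLR) _.
  exact/ladder_atC/ladder_at_cat/ladder_atC.
- by constructor 2; rewrite rev_cut; apply: ladder_at_progress yL yJ sRLR sRL' Ld.
- by constructor 3; apply: three_pathsS P3 => //; [apply: sub_cut_r|apply: sub_cut_l].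
Qed.

(** The paths are quantified because the ladder may use subpaths of the given ones, or one of them
    reversed. *)
Definition path_ladder k (U : seq G) T := exists I J : seq G,
  [/\ ipath I, ipath J, sep I J, {subset I ++ J <= U} & ladder_at k I J T].

(** The exponent 6k is 2k for [two_words], with two targets of k rungs, plus 4k for [three_words],
    with three targets of k rungs and one of k pieces. *)
Lemma ladder_or_pieces k I J T :
  word T I -> word T J -> sep I J -> 16 ^ (6 * k) <= #|T| ->
  path_ladder k (I ++ J) T \/
  exists t t', [/\ t \in T, t' \in T, t != t' & pieces k (I ++ J) t t'].
Proof.
move=> wI wJ S sizeT; have [ipI _ _] := wI; have [ipJ _ _] := wJ.
have big : 16 ^ (k + k) * 16 ^ (k + k + k + k) <= #|T|.
  by rewrite -expnD; apply: leq_trans sizeT; rewrite leq_exp2l //; lia.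
have [|L|L|] := two_words (erefl (k + k)) _ wI wJ S big.
- by rewrite expn_gt0.
- by left; exists I, J; split.
- left; exists I, (rev J); split=> //; first exact: ipath_rev.
    by move=> x y xI; rewrite mem_rev; apply: S.
  by move=> x; rewrite !mem_cat mem_rev.
move=> [s1 [s2 [s3 [T' [sT W mT sub]]]]].
have [[[i1 _ _] [i2 _ _] [i3 _ _]] [S12 S13 S23]] := W.
have [L|L|L|[t [t' [tT t'T tt P]]]] := three_words (erefl (k + k + k + k)) W mT.
- left; exists s1, s2; split=> //; last exact: ladder_atS sT L.
  by move=> x xs; apply: sub; rewrite catA mem_cat xs.
- left; exists s1, s3; split=> //; last exact: ladder_atS sT L.
  move=> x xs; apply: sub; move: xs; rewrite !mem_cat => /orP[]->; by rewrite ?orbT.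
- left; exists s2, s3; split=> //; last exact: ladder_atS sT L.
  by move=> x xs; apply: sub; rewrite mem_cat xs orbT.
right; exists t, t'; split=> //.
- exact: (subsetP sT).
- exact: (subsetP sT).
- exact: pieces_sub P.
Qed.

End WordLadders.


(** * Shortest walks are induced paths *)

Section InducedPaths.
Variable G : sgraph.
Implicit Types (W : {set G}) (s : seq G) (r l x y : G).

Definition walk W r l s := [/\ s != [::], sorted (@edge G) s,
  all [in W] s, head r s = r & last r s = l].

Lemma walk_exists W r l : connected_in W -> r \in W -> l \in W ->
  exists s, walk W r l s.
Proof.
move=> [_ cW] rW lW; have /connectP[p pP ->] := cW r l rW lW.
exists (r :: p); split=> //=.
- by apply: sub_path pP => x y /andP[].
- rewrite rW /=; elim: p r pP {cW rW} => //= x p IHp r.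
  by case/andP=> /andP[/andP[_ ->] _] /IHp.
Qed.

(** A repeated vertex or a chord would allow a shortcut. *)
Lemma shortest_walk_ipath W r l s : walk W r l s ->
  (forall s', walk W r l s' -> size s <= size s') -> ipath s.
Proof.
move=> [s0 ss sW hs ls] smin.
have cut s1 x m y s2 : s = s1 ++ x :: m ++ y :: s2 -> edge x y -> m = [::].
  move=> sE xy; suff : size m == 0 by rewrite size_eq0 => /eqP.
  have : size s <= size (s1 ++ x :: y :: s2); last first.
    by rewrite sE !size_cat /= size_cat /=; lia.
  apply: smin; rewrite sE in ss sW hs ls; split.
  - by case: (s1).
  - move: ss; rewrite !sorted_cat_cons cat_path /= xy => /and3P[-> _ /andP[_ ->]] //.
  - by move: sW; rewrite !all_cat /= !all_cat /= => /and4P[-> -> _ ->].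
  - by case: (s1) hs.
  - by move: ls; rewrite !last_cat /= !last_cat.
have dup s1 x m s2 : s != s1 ++ x :: m ++ x :: s2.
  apply/eqP => sE; have : size s <= size (s1 ++ x :: s2); last first.
    by rewrite sE !size_cat /= size_cat /=; lia.
  apply: smin; rewrite sE in ss sW hs ls; split.
  - by case: (s1).
  - by move: ss; rewrite !sorted_cat_cons cat_path /= => /and3P[-> _ /andP[_ ->]].
  - by move: sW; rewrite !all_cat /= !all_cat /= => /and4P[-> -> _ /andP[]].
  - by case: (s1) hs.
  - by move: ls; rewrite !last_cat /= !last_cat.
have us : uniq s.
  elim: {1 3}s (@nil G) (erefl s : [::] ++ s = s) => // x s' IHs s1 sE /=.
  rewrite (IHs (rcons s1 x)) ?cat_rcons // andbT; apply/negP => /splitPr xs.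
  by case: xs sE => m s2 /esym/eqP; apply/negP.
split=> //; have half x y : x \in s -> y \in s -> index x s < index y s ->
    edge x y = ((index x s).+1 == index y s).
  move=> xs ys; case/splitPr: xs us cut ss ys => s1 s2 us cut ss.
  move: us; rewrite cat_uniq => /and3P[us1 /hasPn d /= /andP[xs2 us2]].
  have xs1 : x \notin s1 by apply: d; rewrite inE eqxx.
  rewrite !index_cat /= (negbTE xs1) eqxx addn0 mem_cat inE.
  case: (boolP (y \in s1)) => [ys1|ys1 /=].
    by rewrite -index_mem in ys1 => _ lt; move: (ltn_trans lt ys1); rewrite ltnn.
  have [->|yx] /= := eqVneq y x; first by rewrite addn0 ltnn.
  move=> ys2 _; rewrite addnS eqSS -{1}[size s1]addn0 eqn_add2l eq_sym.
  case/splitPr: ys2 us2 xs2 ss cut => m s3 + _ ss cut.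
  rewrite cat_uniq => /and3P[_ /hasPn dm _].
  have ym : y \notin m by apply: dm; rewrite inE eqxx.
  rewrite index_cat (negbTE ym) /= eqxx addn0 size_eq0.
  apply/idP/eqP => [xy|m0]; first exact: cut erefl xy.
  by move: ss; rewrite m0 sorted_cat_cons /= => /and3P[].
move=> x y xs ys; have [lt|lt|E] := ltngtP (index x s) (index y s).
- by rewrite half // [(index y s).+1 == _]gtn_eqF ?orbF // ltnS ltnW.
- by rewrite edge_sym half // [(index x s).+1 == _]gtn_eqF // ltnS ltnW.
- have -> : x = y by rewrite -(nth_index x xs) E nth_index.
  by rewrite edge_irrefl gtn_eqF.
Qed.

Lemma induced_path_exists W r l : connected_in W -> r \in W -> l \in W ->
  exists s, [/\ ipath (r :: s), {subset r :: s <= W} & last r s = l].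
Proof.
move=> cW rW lW; have [s ws] := walk_exists cW rW lW.
(* Fixing the size and using tuples makes existence boolean, so that a shortest walk can be
   selected. *)
pose isw n := [exists s : n.-tuple G, [&& s != [::] :> seq G,
  sorted (@edge G) s, all [in W] s, head r s == r & last r s == l]].
have iswP n : reflect (exists s', walk W r l s' /\ size s' = n) (isw n).
  apply: (iffP existsP) => [[s' /and5P[? ? ? /eqP ? /eqP ?]]|[s' [[? ? ? hs ls] /eqP ns]]].
    by exists s'; rewrite size_tuple.
  by exists (Tuple ns); apply/and5P; split=> //=; apply/eqP.
have exn : exists n, isw n by exists (size s); apply/iswP; exists s.
case: (ex_minnP exn) => n /iswP[s' [ws' ns]] minn.
have ips : ipath s'.
  apply: shortest_walk_ipath ws' _ => s2 ws2; rewrite ns.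
  by apply: minn; apply/iswP; exists s2.
case: ws' => + _ /allP sW hs ls; case: s' ips sW hs ls {ns} => //= x s' ips sW xr ls _.
by rewrite xr in ips sW ls; exists s'; split.
Qed.

End InducedPaths.


(** * The skinny ladder as an induced minor *)

Section LadderMinor.
Variable G : sgraph.
Implicit Types (T : {set G}) (s I J : seq G) (t x y z : G).

Section Chunks.
Variables (p : nat -> seq G) (k : nat) (s : seq G).
Hypotheses (ips : ipath (flatten (mkseq p k) ++ s))
  (p_neq0 : forall i, i < k -> p i != [::]).

Let rest i := flatten [seq p j | j <- iota i (k - i)] ++ s.

Let restE i : i <= k -> flatten (mkseq p k) ++ s = flatten (mkseq p i) ++ rest i.
Proof.
move=> ik; rewrite /rest catA -flatten_cat -map_cat.
by rewrite -{2}[i]add0n -iotaD subnKC.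
Qed.

Let rest_cons i : i < k -> rest i = p i ++ rest i.+1.
Proof. by move=> ik; rewrite /rest -[k - i]prednK ?subn_gt0 // -subnS /= -catA. Qed.

Let rest_sub i j : i <= j -> j < k -> {subset p j <= rest i}.
Proof.
move=> ij jk x xp; rewrite mem_cat; apply/orP; left.
apply/flattenP; exists (p j) => //; apply: map_f; rewrite mem_iota ij /=.
by rewrite subnKC // (leq_trans ij) // ltnW.
Qed.

Let ipath_rest i : i <= k -> ipath (rest i).
Proof. by move=> ik; move: ips; rewrite (restE ik) => /ipath_cat[]. Qed.

Lemma chunk_connected i : i < k -> connected_in [set x in p i].
Proof.
move=> ik; have := ipath_rest (ltnW ik); rewrite rest_cons // => /ipath_cat[ipp _].
have := p_neq0 ik; case: (p i) ipp => // x s1 ipp _.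
by apply: ipath_connected ipp (mem_head _ _).
Qed.

Lemma chunk_neq_lt i j x y : i < j -> j < k -> x \in p i -> y \in p j -> x != y.
Proof.
move=> ij jk xi yj; have ik := ltn_trans ij jk.
have [us _] := ipath_rest (ltnW ik); move: us.
rewrite rest_cons // cat_uniq => /and3P[_ /hasPn d _].
by apply: contraTneq xi => ->; apply/d/(rest_sub ij jk).
Qed.

(** If j > i + 1, the first vertex of the chunk i + 1 cuts the path between the two chunks. If j = i
    + 1, the last vertex of [p i] and the first of [p j] are consecutive on the path. *)
Lemma chunk_edge_lt i j : i < j -> j < k ->
  (exists x y, [/\ x \in p i, y \in p j & edge x y]) <-> i.+1 = j.
Proof.
move=> ij jk; have ik := ltn_trans ij jk.
have := ipath_rest (ltnW ik); rewrite rest_cons // => ipi.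
have ik1 : i.+1 < k by apply: leq_ltn_trans jk.
split=> [[x [y [xi yj xy]]]|ji].
  apply/eqP; rewrite eqn_leq ij /= leqNgt; apply/negP => i1j.
  move: ipi; rewrite rest_cons //; case E: (p i.+1) (p_neq0 ik1) => [//|z s1] _.
  move/ipath_cut => /(_ x y xi); rewrite mem_cat (rest_sub i1j jk yj) orbT.
  by case/(_ isT)/andP; rewrite xy.
move: ipi; rewrite rest_cons //; rewrite ji in ik1 *.
case Ej: (p j) (p_neq0 jk) => [//|y s2] _.
case/lastP Ei: (p i) (p_neq0 ik) => [//|s1 x] _ /ipath_link xy.
by exists x, y; rewrite mem_rcons !inE !eqxx.
Qed.

Lemma chunk_neq i j x y : i < k -> j < k -> i != j -> x \in p i -> y \in p j ->
  x != y.
Proof.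
move=> ik jk ij xi yj; case: (ltngtP i j) ij => // [lt|gt] _.
  exact: chunk_neq_lt lt jk xi yj.
by rewrite eq_sym; apply: chunk_neq_lt gt ik yj xi.
Qed.

Lemma chunk_edge i j : i < k -> j < k -> i != j ->
  (exists x y, [/\ x \in p i, y \in p j & edge x y]) <->
  (i.+1 == j) || (j.+1 == i).
Proof.
move=> ik jk ij; case: (ltngtP i j) ij => // [lt|gt] _.
  rewrite [j.+1 == i]gtn_eqF ?orbF; last by rewrite ltnS ltnW.
  by split=> [/(chunk_edge_lt lt jk)/eqP //|/eqP/(chunk_edge_lt lt jk)].
rewrite [i.+1 == j]gtn_eqF; last by rewrite ltnS ltnW.
split=> [[x [y [xi yj xy]]]|/eqP/(chunk_edge_lt gt ik)[y [x [yj xi xy]]]].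
  by apply/eqP/(chunk_edge_lt gt ik); exists y, x; rewrite edge_sym.
by exists x, y; rewrite edge_sym.
Qed.
End Chunks.

Definition independent T := {in T &, forall t t', ~~ edge t t'}.

(** The chunks are the branch sets of the two sides and single letters those of the rungs; the tails
    s and s' lie outside all branch sets. *)
Lemma ladder_induced_minor k I J T :
  ipath I -> ipath J -> sep I J -> independent T ->
  {in T, forall t, t \notin I ++ J} -> ladder_at k I J T ->
  induced_minor (skinny_ladder k) G.
Proof.
move=> ipI ipJ S indT TIJ [p [q [y [[s Is] [s' Js] yT yp yq]]]].
rewrite {}Is {}Js in ipI ipJ S TIJ.
have p0 i : i < k -> p i != [::].
  by move=> ik; have := yp i i ik ik; rewrite eqxx; case: (p i).
have q0 i : i < k -> q i != [::].
  by move=> ik; have := yq i i ik ik; rewrite eqxx; case: (q i).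
have sp i : i < k -> {subset p i <= flatten (mkseq p k) ++ s}.
  by move=> ik x xp; rewrite mem_cat (flatten_sub ik).
have sq i : i < k -> {subset q i <= flatten (mkseq q k) ++ s'}.
  by move=> ik x xp; rewrite mem_cat (flatten_sub ik).
pose f (h : skinny_ladder k) : {set G} := match h with
  | inl (inl i) => [set x in p i] | inl (inr i) => [set x in q i]
  | inr i => [set y i] end.
have yNp (i j : 'I_k) : y i \notin p j.
  apply: contra (TIJ _ (yT _ (ltn_ord i))) => yip.
  by rewrite mem_cat (sp _ _ _ yip).
have yNq (i j : 'I_k) : y i \notin q j.
  apply: contra (TIJ _ (yT _ (ltn_ord i))) => yip.
  by rewrite mem_cat (sq _ _ _ yip) ?orbT.
have Sij (i j : 'I_k) a b : a \in p i -> b \in q j -> (a != b) && ~~ edge a b.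
  by move=> ap bq; apply: S; [apply: sp ap|apply: sq bq].
have y_inj (i j : 'I_k) : y i = y j -> i = j.
  by move=> yE; apply/val_inj/eqP; rewrite -(yp i j) // yE yp.
pose adj (h h' : skinny_ladder k) := [exists x in f h, touch x (f h')].
have adjP h h' : reflect (exists a b, [/\ a \in f h, b \in f h' & edge a b]) (adj h h').
  apply: (iffP exists_inP) => [[a ah /touchP[b]]|[a [b [ah bh ab]]]].
    by exists a, b.
  by exists a => //; apply/touchP; exists b.
have adjC h h' : adj h h' = adj h' h.
  by apply/adjP/adjP => -[a [b [? ? ?]]]; exists b, a; rewrite edge_sym.
have disC h h' : [disjoint f h & f h'] = [disjoint f h' & f h] by apply: disjoint_sym.
have e_sym h h' : edge h h' = edge h' h :> bool by apply: edge_sym.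
suff good (h h' : skinny_ladder k) : h != h' ->
    [disjoint f h & f h'] /\ edge h h' = adj h h'.
  apply: (minor_model_induced (f := f)); split=> [h|h h' /good[]//|h h' /good[]//].
  case: h => [[i|i]|i] /=; last exact: connected1.
    exact: chunk_connected ipI p0 _ (ltn_ord i).
  exact: chunk_connected ipJ q0 _ (ltn_ord i).
have pq (i j : 'I_k) : [disjoint f (inl (inl i)) & f (inl (inr j))] /\
    @edge (skinny_ladder k) (inl (inl i)) (inl (inr j)) = adj (inl (inl i)) (inl (inr j)).
  split.
    apply/pred0P => a /=; apply/negP; rewrite !inE => /andP[ap aq].
    by have := Sij i j a a ap aq; rewrite eqxx.
  apply/esym/adjP => -[a [b []]] /=; rewrite !inE => ap bq.
  by have /andP[_ /negP] := Sij i j a b ap bq.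
have pr (i j : 'I_k) : [disjoint f (inl (inl i)) & f (inr j)] /\
    @edge (skinny_ladder k) (inl (inl i)) (inr j) = adj (inl (inl i)) (inr j).
  split.
    apply/pred0P => a /=; apply/negP; rewrite !inE => /andP[ap /eqP aE].
    by have := yNp j i; rewrite -aE ap.
  rewrite [edge _ _]orbF /= -[i == j]/(val i == val j) eq_sym -(yp j i) //.
  apply/hasP/adjP => [[a ap ya]|[a [b []]] /=].
    by exists a, (y j); rewrite !inE ap eqxx edge_sym.
  by rewrite !inE => ap /eqP-> ay; exists a; rewrite // edge_sym.
have qr (i j : 'I_k) : [disjoint f (inl (inr i)) & f (inr j)] /\
    @edge (skinny_ladder k) (inl (inr i)) (inr j) = adj (inl (inr i)) (inr j).
  split.
    apply/pred0P => a /=; apply/negP; rewrite !inE => /andP[ap /eqP aE].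
    by have := yNq j i; rewrite -aE ap.
  rewrite [edge _ _]orbF /= -[i == j]/(val i == val j) eq_sym -(yq j i) //.
  apply/hasP/adjP => [[a ap ya]|[a [b []]] /=].
    by exists a, (y j); rewrite !inE ap eqxx edge_sym.
  by rewrite !inE => ap /eqP-> ay; exists a; rewrite // edge_sym.
case: h h' => [[i|i]|i] [[j|j]|j] hh.
- have ij : i != j by apply: contraNneq hh => ->.
  split.
    apply/pred0P => a /=; apply/negP; rewrite !inE => /andP[ai aj].
    by have := chunk_neq ipI (ltn_ord i) (ltn_ord j) ij ai aj; rewrite eqxx.
  have E := chunk_edge ipI p0 (ltn_ord i) (ltn_ord j) ij.
  apply/idP/adjP => [/E[a [b [ai bj ab]]]|[a [b []]]].
    by exists a, b; rewrite !inE.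
  by rewrite !inE => ai bj ab; apply/E; exists a, b.
- exact: pq.
- exact: pr.
- by rewrite disC e_sym adjC; apply: pq.
- have ij : i != j by apply: contraNneq hh => ->.
  split.
    apply/pred0P => a /=; apply/negP; rewrite !inE => /andP[ai aj].
    by have := chunk_neq ipJ (ltn_ord i) (ltn_ord j) ij ai aj; rewrite eqxx.
  have E := chunk_edge ipJ q0 (ltn_ord i) (ltn_ord j) ij.
  apply/idP/adjP => [/E[a [b [ai bj ab]]]|[a [b []]]].
    by exists a, b; rewrite !inE.
  by rewrite !inE => ai bj ab; apply/E; exists a, b.
- exact: qr.
- by rewrite disC e_sym adjC; apply: pr.
- by rewrite disC e_sym adjC; apply: qr.
- split.
    apply/pred0P => a /=; apply/negP; rewrite !inE => /andP[/eqP-> /eqP/y_inj E].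
    by rewrite E eqxx in hh.
  apply/esym/adjP => -[a [b []]] /=; rewrite !inE => /eqP-> /eqP->.
  exact/negP/indT/yT/ltn_ord/yT/ltn_ord.
Qed.
End LadderMinor.


(** * Bounding independent sets without common neighbours *)

Lemma leq_card_bigcup (I T : finType) (M : {set I}) (F : I -> {set T}) :
  #|\bigcup_(i in M) F i| <= \sum_(i in M) #|F i|.
Proof.
elim/big_ind2: _ => [|m A n B leA leB|//]; first by rewrite cards0.
exact: leq_trans (leq_card_setU _ _) (leq_add leA leB).
Qed.

(* One factor [k] for each of the two reductions to a single path. *)
Definition chain_bound k := k * k * 16 ^ (6 * k).

Section LongIndependent.
Variables (G : sgraph) (k : nat).
Hypotheses (free : creature_free G k) (k_gt0 : 0 < k).
Implicit Types (A B W E : {set G}) (s U : seq G) (t x y : G).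

(** The hub is t and the far side t'. In each piece, what is reachable from a neighbour of t through
    non-neighbours of t' is a road, and a neighbour of t' just beyond it is its private vertex,
    since the pieces are separated. *)
Lemma pieces_false U t t' : t != t' -> ~~ edge t t' -> t' \notin U ->
  {in U, forall x, ~~ (edge t x && edge t' x)} -> ~ pieces k U t t'.
Proof.
move=> tt nadj t'U nocommon [w [wP wS]].
have /fin_all_exists2 roads (i : 'I_k) : exists2 gb : {set G} * G,
    [/\ connected_in gb.1, gb.1 \subset w i, touch t gb.1 & ~~ touch t' gb.1]
    & [/\ gb.2 \in w i, edge t' gb.2 & touch gb.2 gb.1].
  have [cw wU /touchP[u uw tu] /touchP[v vw tv]] := wP i (ltn_ord i).
  have ut' : ~~ edge t' u by move: (nocommon u (wU u uw)); rewrite tu.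
  pose D := [set x in w i | ~~ edge t' x].
  have uD : u \in D by rewrite inE uw.
  pose g := grow [set u] D.
  have gD : g \subset D.
    by apply: subset_trans (grow_sub _ _) _; rewrite subUset sub1set uD subxx.
  have ug : u \in g by rewrite (subsetP (grow_base _ _)) ?set11.
  have gt' : ~~ touch t' g.
    by apply/touchNP => x /(subsetP gD); rewrite inE => /andP[].
  have vNg : v \notin g.
    by apply: contraL tv => /(subsetP gD); rewrite inE => /andP[].
  have [a [b [aw ag bw bNg ab]]] := connected_exit cw uw ug vw vNg.
  exists (g, b); split=> //=.
  - exact: grow_connected (connected1 u).
  - by apply: subset_trans gD _; apply/subsetP => x; rewrite inE => /andP[].
  - by apply/touchP; exists u.
  - by apply: contraR bNg => ntb; apply: (grow_step ag) ab; rewrite inE bw.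
  - by apply/touchP; exists a; rewrite // edge_sym.
have [gb gP bP] := roads.
have sub_w i x : x \in (gb i).1 -> x \in w i.
  by case: (gP i) => _ /subsetP sw _ _ /sw.
have inU (i : 'I_k) x : x \in w i -> x \in U.
  by have [_ wU _ _] := wP i (ltn_ord i); apply: wU.
apply: (@private_roads_false _ k free k_gt0 [set t] [set t']
  (fun i => (gb i).1) (fun i => (gb i).2)).
- exact: connected1.
- exact: connected1.
- by rewrite disjoints1 inE.
- by move=> x y /set1P-> /set1P->.
- by move=> i; case: (gP i).
- move=> i; rewrite disjoint_sym disjoints1; apply: contra t'U => /sub_w.
  exact: inU.
- move=> i x y xg /set1P->; case: (gP i) => _ _ _ /touchNP/(_ x xg).
  by rewrite edge_sym.
- move=> i; case: (gP i) => _ _ /touchP[u ug tu] _.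
  by exists u; rewrite // touch1 edge_sym.
- move=> i; case: (bP i) => bw tb _; rewrite touch1 edge_sym.
  by apply: contra (nocommon _ (inU _ _ bw)) => ->.
- by move=> i; case: (bP i) => _ tb _; rewrite touch1 edge_sym.
- move=> i j; have [<-|ij] := eqVneq i j; first by case: (bP i).
  apply/touchP => -[x xg bx]; case: (bP i) => bw _ _.
  have /andP[_ /negP[]] // := wS i j (ltn_ord i) (ltn_ord j) ij _ _ bw (sub_w _ _ xg).
Qed.

(** Fix a root r in W and an induced path from r to each vertex of W. Without r these are roads from
    the hub r with far side B, so fewer than k of them reach all of E not adjacent to r, and the
    best one reaches a fraction 1/k of E. *)
Lemma path_cover W B E : connected_in W -> connected_in B ->
  [disjoint W & B] -> anticomplete W B ->
  {in E, forall t, touch t W /\ touch t B} ->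
  exists s, [/\ ipath s, {subset s <= W}
    & #|E| <= k * #|[set t in E | touchs t s]|].
Proof.
move=> cW cB dWB acWB tE; have [/set0Pn[r rW] _] := cW.
have /fin_all_exists[P PP] l : exists s, l \in W ->
    [/\ ipath (r :: s), {subset r :: s <= W} & last r s = l].
  have [lW|lW] := boolP (l \in W); last by exists [::].
  by have [s] := induced_path_exists cW rW lW; exists s.
have PW l x : l \in W -> x \in P l -> x \in W.
  by move=> lW xP; have [_ sub _] := PP l lW; apply: sub; rewrite inE xP orbT.
(* Neighbours of r touch the hub and cannot enter the covering; every path in question contains r,
   so they are touched anyway. *)
pose Y := [set t in E | ~~ edge t r].
have [||l|t|M [sMW Mk Mcov]] := @road_cover _ k free k_gt0 G (W :\ r)
    (fun l => [set x in P l]) [set r] B Y (connected1 r) cB.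
- by rewrite disjoints1 (disjointFr dWB).
- by move=> x y /set1P->; apply: acWB.
- rewrite !inE => /andP[lr lW]; have [ips sub lE] := PP l lW.
  case EP: (P l) lE ips => [|x s] lE ips; first by rewrite -lE eqxx in lr.
  have [_ ips'] := @ipath_cat _ [:: r] _ ips.
  have sW y : y \in x :: s -> y \in W by rewrite -EP; apply: PW.
  split.
  + exact: ipath_connected ips' (mem_head _ _).
  + by apply/pred0P => y /=; rewrite inE; apply/negP => /andP[/sW/(disjointFr dWB)->].
  + by move=> y z; rewrite inE => /sW; apply: acWB.
  + exists x; rewrite ?inE ?eqxx // touch1 edge_sym.
    exact: (@ipath_link _ [::] r x s ips).
- rewrite inE => /andP[tinE ntr]; have [/touchP[l lW tl] tB] := tE t tinE.
  rewrite touch1 ntr; split=> //; exists l.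
    by rewrite !inE lW andbT; apply: contraNneq ntr => <-.
  have [_ _ lE] := PP l lW; apply/touchP; exists l => //.
  rewrite inE -{1}lE; case: (P l) lE => [lE|x s _]; last by rewrite /= mem_last.
  by rewrite /= in lE; rewrite lE tl in ntr.
pose F l := [set t in E | touchs t (r :: P l)].
have [M0|/set0Pn[l0 l0M]] := eqVneq M set0.
  exists [:: r]; split.
  - by have [s [ips _ _]] := induced_path_exists cW rW rW; case: (@ipath_cat _ [:: r] _ ips).
  - by move=> x; rewrite inE => /eqP->.
  - apply: leq_trans (leq_pmull _ k_gt0); apply/subset_leq_card/subsetP => t tE'.
    rewrite inE tE' /= orbF; apply: contraT => ntr.
    by have [|i] := Mcov t; [rewrite inE tE'|rewrite M0 inE].
have [l lM maxl] := @arg_maxnP _ l0 (mem M) (fun l => #|F l|) l0M.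
have lW : l \in W by have := subsetP sMW l lM; rewrite inE => /andP[].
exists (r :: P l); have [ips sub _] := PP l lW; split=> //.
have : #|E| <= \sum_(i in M) #|F i|.
  apply: leq_trans (leq_card_bigcup _ _); apply/subset_leq_card/subsetP => t tE'.
  have [tr|ntr] := boolP (edge t r).
    by apply/bigcupP; exists l0 => //; rewrite inE tE' touchs_cons tr.
  have [|i iM ti] := Mcov t; first by rewrite inE tE'.
  by apply/bigcupP; exists i => //; rewrite inE tE' touchs_cons -touch_set ti orbT.
move/leq_trans; apply; apply: leq_trans (_ : #|M| * #|F l| <= _).
  by rewrite -sum_nat_const; apply: leq_sum => i /maxl.
by rewrite leq_mul2r ltnW ?orbT.
Qed.

Hypothesis noladder : ~ induced_minor (skinny_ladder k) G.

Lemma long_independent_false A B E : connected_in A -> connected_in B ->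
  [disjoint A & B] -> anticomplete A B ->
  {in E, forall t, [/\ touch t A, touch t B & t \notin A :|: B]} ->
  independent E ->
  {in A :|: B, forall x, {in E &, forall t t', edge t x -> edge t' x -> t = t'}} ->
  #|E| < chain_bound k.
Proof.
move=> cA cB dAB acAB tE indE oneE; rewrite ltnNge; apply/negP => bigE.
have [|I [ipI sI cardI]] := path_cover cA cB dAB acAB (E := E).
  by move=> t /tE[].
set E1 := [set t in E | _] in cardI.
have sE1 t : t \in E1 -> t \in E by rewrite inE => /andP[].
have [|||J [ipJ sJ cardJ]] := @path_cover B A E1 cB cA.
- by rewrite disjoint_sym.
- exact: anticompleteC.
- by move=> t /sE1/tE[].
set E2 := [set t in E1 | _] in cardJ.
have sE2 t : t \in E2 -> t \in E by rewrite inE => /andP[/sE1].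
have IJ_AB x : x \in I ++ J -> x \in A :|: B.
  by rewrite mem_cat inE => /orP[/sI->|/sJ->]; rewrite ?orbT.
have bigE2 : 16 ^ (6 * k) <= #|E2|.
  have kk : 0 < k * k by rewrite muln_gt0 k_gt0.
  rewrite -(leq_pmul2l kk); apply: leq_trans bigE _; apply: leq_trans cardI _.
  by rewrite -mulnA leq_mul2l cardJ orbT.
have one2 s : {subset s <= I ++ J} -> single_touch E2 s.
  by move=> sub x /sub/IJ_AB xAB t t' /sE2 tE2 /sE2 t'E2; apply: oneE.
have wI : word E2 I.
  split=> //; first by apply: one2 => x xI; rewrite mem_cat xI.
  by move=> t; rewrite !inE => /andP[/andP[]].
have wJ : word E2 J.
  split=> //; first by apply: one2 => x xI; rewrite mem_cat xI orbT.
  by move=> t; rewrite !inE => /andP[].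
have S : sep I J.
  move=> x y /sI xA /sJ yB; rewrite acAB // andbT.
  by apply: contraTneq xA => ->; rewrite (disjointFl dAB).
have notIJ t : t \in E2 -> t \notin I ++ J.
  by move/sE2/tE=> [_ _]; apply/contra/IJ_AB.
have [[I' [J' [ip1 ip2 S' sub L]]]|[t [t' [tE2 t'E2 t_t' P]]]] := ladder_or_pieces wI wJ S bigE2.
  apply: noladder; apply: ladder_induced_minor ip1 ip2 S' _ _ L.
    by move=> t t' /sE2 ? /sE2 ?; apply: indE.
  by move=> t tE2; apply: contra (notIJ t tE2) => /sub.
apply: (pieces_false t_t' _ _ _ P).
- by apply: indE; apply: sE2.
- exact: notIJ.
- move=> x /IJ_AB xAB; apply/negP => /andP[tx t'x].
  by case/eqP: t_t'; apply: (oneE x xAB) => //; apply: sE2.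
Qed.
End LongIndependent.


(** * Reconstructing a separator from few vertices *)

Section Guesses.
Variable G : sgraph.
Implicit Types (A B C D H K M S V W X Y : {set G}) (x y : G).

(** The closed neighbourhood N[X]; [locked] keeps [inE] from unfolding it. *)
Definition cnbhd X := locked (X :|: nbhd X).

Lemma in_cnbhd X y : (y \in cnbhd X) = (y \in X) || touch y X.
Proof. by rewrite /cnbhd -lock inE in_nbhd; case: (y \in X). Qed.

Lemma cnbhdS X Y : X \subset Y -> cnbhd X \subset cnbhd Y.
Proof.
move=> sXY; apply/subsetP => y; rewrite !in_cnbhd.
by move=> /orP[/(subsetP sXY)->|/(touch_sub sXY)->]; rewrite ?orbT.
Qed.

(* Here [C] is a set already known to lie in the component [A] of [G - S]; when
   [H], [V] and [C] together dominate [S], the guessed set [B0] is grown inside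
   the other component [B], which protects enough of [S] to grow [A0] in [A]. *)
Definition guess_step C H V A0 B0 :=
  let known := cnbhd C :|: cnbhd H :|: cnbhd V in
  let Bs := grow B0 (~: known) in
  grow A0 (~: (nbhd Bs :|: cnbhd H :|: cnbhd V)).

Definition guesses m : {set ({set G} * {set G}) * ({set G} * {set G})} :=
  setX (setX [set X : {set G} | #|X| <= m] [set X : {set G} | #|X| <= m])
       (setX [set X : {set G} | #|X| <= m] [set X : {set G} | #|X| <= m]).

(** The family depends on G, m and n but not on S, so its size bounds the number of sets C that can
    arise from all separators. *)
Fixpoint reachable m n : {set {set G}} :=
  if n is n'.+1 then
    [set guess_step x.1 x.2.1.1 x.2.1.2 x.2.2.1 x.2.2.2
      | x in setX (reachable m n') (guesses m)]
  else [set set0].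

Lemma reachable_step m n C H V A0 B0 : C \in reachable m n ->
  #|H| <= m -> #|V| <= m -> #|A0| <= m -> #|B0| <= m ->
  guess_step C H V A0 B0 \in reachable m n.+1.
Proof.
move=> Cn Hm Vm Am Bm; apply/imsetP; exists (C, ((H, V), (A0, B0))) => //.
by rewrite !inE /= Cn Hm Vm Am Bm.
Qed.

Lemma grow0 D : grow set0 D = set0.
Proof.
by apply/eqP; rewrite -subset0; apply: grow_ind => // a b; rewrite inE.
Qed.

(** Empty guesses keep the empty set available at every level, so a descent that ends early still
    has a starting point. *)
Lemma reachable0 m n : set0 \in reachable m n.
Proof.
elim: n => [|n IHn]; first by rewrite /= set11.
have <- : guess_step set0 set0 set0 set0 set0 = set0 by apply: grow0.
by apply: reachable_step; rewrite ?cards0.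
Qed.

Lemma connected_star K M : connected_in K -> {in M, forall x, touch x K} ->
  connected_in (K :|: M).
Proof.
move=> cK MK; have [/set0Pn[x xK] _] := cK.
apply: (@connected_intro _ _ x); first by rewrite inE xK.
move=> Z xZ closedZ; have sKZ : K \subset Z.
  apply: connected_ind cK xK xZ _ => a b aK aZ bK.
  by apply: closedZ; rewrite ?inE ?aK ?bK.
rewrite subUset sKZ; apply/subsetP => y yM; have /touchP[z zK yz] := MK y yM.
apply: (closedZ z); rewrite ?inE ?zK ?yM ?orbT ?(subsetP sKZ) //.
by rewrite edge_sym.
Qed.
End Guesses.

(** * Descent and reconstruction for a fixed separator *)

Section Reconstruction.
Variables (G : sgraph) (k : nat).
Hypotheses (free : creature_free G k) (k_gt0 : 0 < k)
  (noladder : ~ induced_minor (skinny_ladder k) G).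
Variables S A B : {set G}.
Hypotheses (cA : connected_in A) (cB : connected_in B) (dAB : [disjoint A & B])
  (nA : nbhd A = S) (nB : nbhd B = S).
Implicit Types (C D E H K M T V W X Y : {set G}) (e h t u v x y : G).

Let inS_A t : t \in S -> (t \notin A) /\ touch t A.
Proof. by rewrite -nA in_nbhd => /andP. Qed.

Let inS_B t : t \in S -> (t \notin B) /\ touch t B.
Proof. by rewrite -nB in_nbhd => /andP. Qed.

Let stepA a b : a \in A -> edge a b -> (b \in A) || (b \in S).
Proof.
move=> aA ab; rewrite -nA in_nbhd; case: (b \in A) => //=.
by apply/touchP; exists a; rewrite // edge_sym.
Qed.

Let stepB a b : a \in B -> edge a b -> (b \in B) || (b \in S).
Proof.
move=> aB ab; rewrite -nB in_nbhd; case: (b \in B) => //=.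
by apply/touchP; exists a; rewrite // edge_sym.
Qed.

Let acAB : anticomplete A B.
Proof.
move=> a b aA bB; apply/negP => ab; have := stepA aA ab.
by rewrite (disjointFl dAB bB) /= => /inS_B[]; rewrite bB.
Qed.

(** [road_cover] with hub h, far side K and the single vertices of X as roads. *)
Lemma hub_cover h K X T : connected_in K -> h \notin K -> ~~ touch h K ->
  {in X, forall x, [/\ edge h x, x \notin K & ~~ touch x K]} ->
  {in T, forall t, [/\ ~~ edge t h, touch t K & touch t X]} ->
  exists M, [/\ M \subset X, #|M| < k & {in T, forall t, touch t M}].
Proof.
move=> cK hK nhK XP TP.
have [||x xX|t tT|M [sMX Mk Mcov]] := @road_cover _ k free k_gt0 G X
    (fun x => [set x]) [set h] K T (connected1 h) cK.
- by rewrite disjoints1.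
- by move=> x y /set1P-> yK; apply: (elimT (touchNP _ _) nhK).
- have [hx xK nxK] := XP x xX; split.
  + exact: connected1.
  + by rewrite disjoints1.
  + by move=> z y /set1P-> yK; apply: (elimT (touchNP _ _) nxK).
  + by exists x; rewrite ?set11 // touch1 edge_sym.
- have [nth tK /touchP[x xX tx]] := TP t tT; rewrite touch1; split=> //.
  by exists x; rewrite ?touch1.
exists M; split=> // t /Mcov[x xM]; rewrite touch1 => tx.
by apply/touchP; exists x.
Qed.

Variable A' : {set G}.
Hypotheses (cA' : connected_in A') (sA' : A' \subset A)
  (domA' : {in S, forall t, touch t A'})
  (minA' : forall K, K \subset A' -> connected_in K ->
     {in S, forall t, touch t K} -> K = A').

Definition frontier K := [set x in A' | (x \notin K) && touch x K].

(** Absorbing a frontier vertex that has a neighbour in A' beyond the frontier does not shrink the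
    frontier, so K may grow until A' is K with its frontier. Then fewer than k frontier vertices
    touch all of S that K misses; together with K they form a connected dominating set, so by
    minimality of A' they are the whole frontier. *)
Lemma frontier_small K : connected_in K -> K \subset A' -> #|frontier K| < k.
Proof.
have [n] := ubnP (#|A'| - #|K|); elim: n K => // n IHn K leK cK sK.
have [/existsP[x /andP[xF /existsP[y]]]|closed] :=
  boolP [exists x in frontier K, exists y, [&& y \in A', y \notin K,
    y \notin frontier K & edge y x]].
  move=> /and4P[yA yK yF yx].
  move: (xF); rewrite inE => /and3P[xA xK xtK].
  have sxK : x |: K \subset A' by rewrite subUset sub1set xA.
  apply: leq_trans (IHn (x |: K) _ (connected_add cK xtK) sxK); last first.
    have : #|K| < #|A'| by apply/proper_card/properP; split=> //; exists x.
    by rewrite cardsU1 xK; move: leK; clear; lia.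
  rewrite ltnS (cardsD1 x) xF.
  have yNF : y \notin frontier K :\ x by rewrite inE (negbTE yF) andbF.
  rewrite (_ : true + _ = #|y |: frontier K :\ x|); last by rewrite cardsU1 yNF.
  apply/subset_leq_card/subsetP => z; rewrite !inE => /orP[/eqP->|].
    rewrite yA (negbTE yK) orbF touchU touch1 yx /= andbT.
    by apply: contraNneq yF => ->.
  by case/and4P=> zx zA zK ztK; rewrite zA (negbTE zx) zK touchU ztK orbT.
pose Y := [set t in S | ~~ touch t K].
have [||x|t|M [sMF Mk Mcov]] := @road_cover _ k free k_gt0 G (frontier K)
    (fun x => [set x]) K B Y cK cB.
- by apply: disjointWl dAB; apply: subset_trans sA'.
- by apply: anticompleteS acAB => //; apply: subset_trans sA'.
- rewrite inE => /and3P[xA xK xtK]; have xinA := subsetP sA' x xA; split.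
  + exact: connected1.
  + by rewrite disjoints1 (disjointFr dAB xinA).
  + by move=> z y /set1P->; apply: acAB.
  + by exists x; rewrite ?set11.
- rewrite inE => /andP[tS ntK]; split=> //; first by case: (inS_B tS).
  have /touchP[x xA' tx] := domA' tS; exists x; last by rewrite touch1.
  have [/set0Pn[r rK] _] := cK.
  have sub : A' \subset K :|: frontier K.
    apply: connected_ind cA' (subsetP sK r rK) _ _; first by rewrite inE rK.
    move=> a b aA aKF bA ab.
    have [bK|bK] := boolP (b \in K); first by rewrite inE bK.
    rewrite inE (negbTE bK) /=; move: aKF; rewrite inE => /orP[aK|aF].
      by rewrite inE bA bK; apply/touchP; exists a; rewrite // edge_sym.
    apply: contraR closed => bF; apply/existsP; exists a; rewrite aF /=.
    by apply/existsP; exists b; rewrite bA bK bF edge_sym.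
  have := subsetP sub x xA'; rewrite inE => /orP[xK|//].
  by case/negP: ntK; apply/touchP; exists x.
suff -> : frontier K = M by [].
apply/eqP; rewrite eqEsubset sMF andbT.
have KM : K :|: M = A'.
  apply: minA'.
  - rewrite subUset sK; apply: subset_trans sMF _.
    by apply/subsetP => x; rewrite inE => /andP[].
  - by apply: connected_star cK _ => x /(subsetP sMF); rewrite inE => /and3P[].
  - move=> t tS; rewrite touchU; have [//|ntK] := boolP (touch t K).
    have [|x xM] := Mcov t; first by rewrite inE tS.
    by rewrite touch1 => tx; apply/touchP; exists x.
apply/subsetP => x; rewrite inE -KM => /and3P[+ xK _].
by rewrite inE (negbTE xK).
Qed.

Definition open_part H V := [set t in S | (t \notin cnbhd H) && (t \notin cnbhd V)].

Lemma star_small V : V \subset A' -> #|A' :&: cnbhd V| <= k * #|V|.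
Proof.
move=> sV; have -> : A' :&: cnbhd V = \bigcup_(v in V) (A' :&: cnbhd [set v]).
  apply/setP => y; rewrite inE in_cnbhd; apply/andP/bigcupP => [[yA /orP[yV|]]|].
  - by exists y; rewrite // inE yA in_cnbhd set11.
  - by case/touchP=> v vV yv; exists v; rewrite // inE yA in_cnbhd touch1 yv orbT.
  - case=> v vV; rewrite inE in_cnbhd touch1 => /andP[-> /orP[/set1P->|yv]].
      by rewrite vV.
    by split=> //; apply/orP; right; apply/touchP; exists v.
apply: leq_trans (leq_card_bigcup _ _) _; rewrite mulnC -sum_nat_const.
apply: leq_sum => v vV; have vA := subsetP sV v vV.
apply: leq_trans (_ : #|v |: frontier [set v]| <= _).
  apply/subset_leq_card/subsetP => y; rewrite !(inE, in_cnbhd).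
  by case/andP=> -> /orP[->//|->]; case: (y == v).
apply: leq_trans (leq_card_setU _ _) _; rewrite cards1 add1n.
by apply: frontier_small; [apply: connected1|rewrite sub1set].
Qed.

(** K is the far side throughout. For each h in H, fewer than k neighbours of h in B serve the
    vertices of the open part that share a neighbour in B with h, and fewer than k components of B -
    N[H] attached to neighbours of h serve the others; the last seed is for the case that B avoids
    N[H]. *)
Lemma guess_B H V K : H \subset S :|: B ->
  {in H, forall h, ~~ touch h K} -> K \subset A -> connected_in K ->
  {in open_part H V, forall t, touch t K} ->
  exists B0 : {set G}, [/\ B0 \subset B, #|B0| <= k * #|H| + k * #|H| + 1
    & {in open_part H V, forall t, touch t (grow B0 (B :\: cnbhd H))}].
Proof.
move=> sH nHK sK cK TK; set T := open_part H V in TK *.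
have [/set0Pn[b0 b0B] _] := cB.
pose NB h := [set x in B | edge h x].
pose Bo := B :\: cnbhd H.
pose comp b := grow [set b] Bo.
have hK h : h \in H -> h \notin K.
  move=> /(subsetP sH); rewrite inE => /orP[/inS_A[hA _]|hB].
    by apply: contra hA; apply: (subsetP sK).
  by apply: contraTN hB => /(subsetP sK)/(disjointFr dAB)->.
have BK x : x \in B -> (x \notin K) /\ ~~ touch x K.
  move=> xB; split; first by apply: contraTN xB => /(subsetP sK)/(disjointFr dAB)->.
  by apply/touchNP => y /(subsetP sK) yA; rewrite edge_sym acAB.
have tH t h : t \in T -> h \in H -> ~~ edge t h.
  rewrite inE in_cnbhd negb_or => /and3P[_ /andP[_ ntH] _] hH.
  by apply: contra ntH => th; apply/touchP; exists h.
have /fin_all_exists[M1 M1P] h : exists M : {set G}, h \in H -> [/\ M \subset B, #|M| < k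
    & {in T, forall t, touch t (NB h) -> touch t M}].
  have [hH|] := boolP (h \in H); last by exists set0.
  have [||M [sM Mk Mcov]] := @hub_cover h K (NB h) [set t in T | touch t (NB h)]
    cK (hK h hH) (nHK h hH).
  - by move=> x; rewrite inE => /andP[/BK[]].
  - by move=> t; rewrite inE => /andP[tT tN]; rewrite (tH t h) // TK.
  exists M => _; split=> //.
    by apply: subset_trans sM _; apply/subsetP => x; rewrite inE => /andP[].
  by move=> t tT tN; apply: Mcov; rewrite inE tT.
(* Seeds of the components of B - N[H] that touch a neighbour of h in B: the roads leaving the hub
   formed by h and these neighbours. *)
pose gaps h := [set b in Bo | [exists u in comp b, touch u (NB h)]].
have compB b : b \in Bo -> comp b \subset Bo.
  move=> bBo; apply: subset_trans (grow_sub _ _) _.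
  by rewrite subUset sub1set bBo subxx.
have sBo : Bo \subset B by apply: subsetDl.
have /fin_all_exists[M2 M2P] h : exists M : {set G}, h \in H -> [/\ M \subset B, #|M| < k
    & {in T, forall t, ~~ touch t (NB h) ->
        forall b, b \in gaps h -> touch t (comp b) ->
        exists2 b', b' \in M & touch t (comp b')}].
  have [hH|] := boolP (h \in H); last by exists set0.
  have cN : connected_in ([set h] :|: NB h).
    apply: connected_star (connected1 h) _ => x.
    by rewrite inE touch1 edge_sym => /andP[].
  have [||b|t|M [sM Mk Mcov]] := @road_cover _ k free k_gt0 G (gaps h) comp
     ([set h] :|: NB h) K [set t in T | ~~ touch t (NB h)
       & [exists b in gaps h, touch t (comp b)]] cN cK.
  - apply/pred0P => x /=; rewrite !inE; apply/negP => /andP[/orP[/eqP->|]].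
      by rewrite (negbTE (hK h hH)).
    by case/andP=> /BK[/negbTE->].
  - move=> x y; rewrite !inE => /orP[/eqP-> yK|/andP[/BK[_ /touchNP nx] _]].
      exact: (elimT (touchNP _ _) (nHK h hH)).
    exact: nx.
  - rewrite inE => /andP[bBo /exists_inP[u uc uN]].
    have cB' x : x \in comp b -> x \in B.
      by move/(subsetP (compB b bBo))/(subsetP sBo).
    split.
    + exact: grow_connected (connected1 b).
    + by apply/pred0P => x /=; apply/negP => /andP[/cB'/BK[/negbTE->]].
    + by move=> x y /cB'/BK[_ /touchNP]; apply.
    + by exists u => //; apply: touch_sub uN; apply: subsetUr.
  - rewrite inE => /and3P[tT ntN /exists_inP[b bg tb]].
    rewrite touchU touch1 (negbTE ntN) orbF (tH t h) // TK //; split=> //.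
    by exists b.
  exists M => _; split=> //.
    by apply: subset_trans sM _; apply/subsetP => x; rewrite inE => /andP[/(subsetP sBo)].
  move=> t tT ntN b bg tb; apply: Mcov; rewrite inE tT ntN.
  by apply/exists_inP; exists b.
pose B1 := \bigcup_(h in H) M1 h; pose B2 := \bigcup_(h in H) M2 h.
exists (B1 :|: B2 :|: [set b0]).
have big_le (M : G -> {set G}) : {in H, forall h, #|M h| < k} ->
    #|\bigcup_(h in H) M h| <= k * #|H|.
  move=> Mk; apply: leq_trans (leq_card_bigcup _ _) _.
  by rewrite mulnC -sum_nat_const; apply: leq_sum => h /Mk/ltnW.
split.
- rewrite !subUset sub1set b0B andbT; apply/andP; split; apply/bigcupsP => h hH.
    by case: (M1P h hH).
  by case: (M2P h hH).
- apply: leq_trans (leq_card_setU _ _) _; rewrite cards1 leq_add2r.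
  apply: leq_trans (leq_card_setU _ _) _; apply: leq_add; apply: big_le => h hH.
    by case: (M1P h hH).
  by case: (M2P h hH).
move=> t tT; set B0 := _ :|: _.
have comp_sub b : b \in B0 -> comp b \subset grow B0 Bo.
  by move=> bB; apply: grow_mono => //; rewrite sub1set.
have byN h : h \in H -> touch t (NB h) -> touch t (grow B0 Bo).
  move=> hH tN; have [_ _ Mcov] := M1P h hH.
  apply: touch_sub (Mcov t tT tN); apply: subset_trans (grow_base _ _).
  rewrite /B0 -setUA; apply: subset_trans (subsetUl _ _).
  exact: bigcup_sup.
have tS : t \in S by move: tT; rewrite inE => /andP[].
have [_ /touchP[b bB tb]] := inS_B tS.
have [bH|bNH] := boolP (b \in cnbhd H).
  move: bH; rewrite in_cnbhd => /orP[bH|/touchP[h hH bh]].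
    by move: (tH t b tT bH); rewrite tb.
  apply: (byN h hH); apply/touchP; exists b => //.
  by rewrite inE bB edge_sym.
have bBo : b \in Bo by rewrite inE bNH.
have bc : b \in comp b by rewrite (subsetP (grow_base _ _)) ?set11.
have tc : touch t (comp b) by apply/touchP; exists b.
have [sBc|/subsetPn[c cinB cNc]] := boolP (B \subset comp b).
  have sBBo := subset_trans sBc (compB b bBo).
  have b0g : b0 \in grow B0 Bo.
    by apply: (subsetP (grow_base _ _)); rewrite /B0 !inE eqxx !orbT.
  apply/touchP; exists b => //.
  exact: (subsetP (grow_absorb cB sBBo b0B b0g)).
have [a [d [aB ac dB dNc ad]]] := connected_exit cB bB bc cinB cNc.
have aBo := subsetP (compB b bBo) a ac.
have dH : d \in cnbhd H.
  by apply: contraR dNc => dNH; apply: (grow_step ac) ad; rewrite inE dNH.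
have [h hH dh] : exists2 h, h \in H & edge d h.
  move: dH; rewrite in_cnbhd => /orP[dH|/touchP[h hH dh]]; last by exists h.
  move: aBo; rewrite inE in_cnbhd negb_or => /andP[/andP[_ /touchNP/(_ d dH)]].
  by rewrite ad.
have [|ntN] := boolP (touch t (NB h)); first exact: byN.
have bg : b \in gaps h.
  rewrite inE bBo; apply/exists_inP; exists a => //.
  by apply/touchP; exists d; rewrite // inE dB edge_sym.
have [_ _ Mcov] := M2P h hH; have [b' b'M tb'] := Mcov t tT ntN b bg tc.
apply: touch_sub tb'; apply: comp_sub; rewrite /B0 !inE.
by apply/orP; left; apply/orP; right; apply/bigcupP; exists h.
Qed.

(** N[C], N[H] and N[V] together contain S, as [K2] lies in C and touches whatever H and V leave
    open; hence [Bs] stays in B. Since [Bs] touches that open part too, N(Bs), N[H] and N[V] contain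
    S, and the second growth stays in A. K avoids N(Bs) and N[H]; where N[V] would interrupt it, the
    seeds contain all of N[V] in A', which is small by [star_small]. *)
Lemma guess_step_correct C H V K2 K : C \subset A -> K2 \subset C ->
  H \subset S :|: B -> V \subset A' -> K \subset A' -> connected_in K ->
  {in H, forall h, ~~ touch h K} -> {in H, forall h, ~~ touch h K2} ->
  open_part H V = set0 \/
    connected_in K2 /\ {in open_part H V, forall t, touch t K2} ->
  exists A0 B0 : {set G}, [/\ #|A0| <= k * #|V| + 1,
    #|B0| <= k * #|H| + k * #|H| + 1,
    guess_step C H V A0 B0 \subset A & K \subset guess_step C H V A0 B0].
Proof.
move=> sC sK2 sH sV sK cK nHK nHK2 TK2; set T := open_part H V in TK2 *.
have [B0 [sB0 cardB0 TB0]] : exists B0 : {set G}, [/\ B0 \subset B,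
    #|B0| <= k * #|H| + k * #|H| + 1
    & {in T, forall t, touch t (grow B0 (B :\: cnbhd H))}].
  case: TK2 => [T0|[cK2 TK2]].
    by exists set0; rewrite sub0set cards0; split=> // t; rewrite T0 inE.
  exact: guess_B sH nHK2 (subset_trans sK2 sC) cK2 TK2.
have [/set0Pn[k0 k0K] _] := cK; have k0A' := subsetP sK k0 k0K.
exists ((A' :&: cnbhd V) :|: [set k0]), B0.
have cB_no X x : X \subset A -> x \in B -> x \notin cnbhd X.
  move=> sX xB; rewrite in_cnbhd negb_or; apply/andP; split.
    by apply: contraTN xB => /(subsetP sX)/(disjointFr dAB)->.
  by apply/touchNP => y /(subsetP sX) yA; rewrite edge_sym acAB.
have openP s : s \in S -> [\/ s \in cnbhd H, s \in cnbhd V | s \in T].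
  move=> sS; have [|nH] := boolP (s \in cnbhd H); first by constructor 1.
  have [|nV] := boolP (s \in cnbhd V); first by constructor 2.
  by constructor 3; rewrite inE sS nH.
have SR1 s : s \in S -> s \in cnbhd C :|: cnbhd H :|: cnbhd V.
  move=> sS; rewrite !in_setU; case: (openP s sS) => [->|->|sT].
  - by rewrite !orbT.
  - by rewrite !orbT.
  case: TK2 => [T0|[_ TK2]]; first by rewrite T0 inE in sT.
  by rewrite in_cnbhd (touch_sub sK2 (TK2 s sT)) orbT.
rewrite /guess_step /=; set R1 := cnbhd C :|: cnbhd H :|: cnbhd V; set Bs := grow B0 _.
have sBs : Bs \subset B.
  apply: grow_ind => // a b aB bR ab; have /orP[//|/SR1 bR1] := stepB aB ab.
  by move: bR; rewrite inE bR1.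
have TBs t : t \in T -> touch t Bs.
  move/TB0; apply: touch_sub; apply: grow_mono => //; apply/subsetP => x.
  rewrite in_setD in_setC !in_setU => /andP[xH xB].
  by rewrite (negbTE xH) (negbTE (cB_no _ _ sC xB))
     (negbTE (cB_no _ _ (subset_trans sV sA') xB)).
set R2 := _ :|: cnbhd V.
have SR2 s : s \in S -> s \in R2.
  move=> sS; rewrite !in_setU; case: (openP s sS) => [->|->|sT].
  - by rewrite !orbT.
  - by rewrite !orbT.
  rewrite in_nbhd TBs // andbT; case: (inS_B sS) => sB _.
  by rewrite (contra _ sB) //; apply: (subsetP sBs).
split=> //.
- apply: leq_trans (leq_card_setU _ _) _; rewrite cards1 leq_add2r.
  exact: star_small.
- apply: grow_ind => [|a b aA bR ab].
    rewrite subUset sub1set (subsetP sA') // andbT.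
    exact: subset_trans (subsetIl _ _) sA'.
  have /orP[//|/SR2 bR2] := stepA aA ab.
  by move: bR; rewrite inE bR2.
have base x : x \in A' :&: cnbhd V :|: [set k0] ->
    x \in grow (A' :&: cnbhd V :|: [set k0]) (~: R2).
  exact: (subsetP (grow_base _ _)).
apply: (connected_ind cK k0K); first by apply: base; rewrite in_setU set11 orbT.
move=> a b aK aG bK ab; have bA' := subsetP sK b bK.
have [bV|bV] := boolP (b \in cnbhd V).
  by apply: base; rewrite in_setU in_setI bA' bV.
apply: (grow_step aG) ab; rewrite in_setC !in_setU (negbTE bV) orbF negb_or.
have bA := subsetP sA' b bA'; apply/andP; split.
  rewrite in_nbhd negb_and; apply/orP; right; apply/touchNP => x /(subsetP sBs).
  exact: acAB.
rewrite in_cnbhd negb_or; apply/andP; split.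
  apply/negP => /(subsetP sH); rewrite inE (disjointFr dAB bA) orbF.
  by case/inS_A; rewrite bA.
apply/touchNP => h hH; rewrite edge_sym; exact: (elimT (touchNP _ _) (nHK h hH)).
Qed.

(** A boolean form of [connected_in], as required for choosing extremal sets. *)
Definition conn W := (W != set0) &&
  [forall x in W, forall y in W, connect (induced_rel W) x y].

Lemma connP W : reflect (connected_in W) (conn W).
Proof.
apply: (iffP andP) => [[W0 /forall_inP cW]|[W0 cW]]; split=> //.
  by move=> x y xW yW; move/forall_inP: (cW x xW); apply.
by apply/forall_inP => x xW; apply/forall_inP => y yW; apply: cW.
Qed.

(* [K2] is a maximal connected subset of [K] that fails to dominate [T]. *)
Lemma exposed_vertex K T x0 : connected_in K -> x0 \in K ->
  {in T, forall t, touch t K} ->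
  {in T, forall t, edge t x0} \/
  exists K2 v e, [/\ K2 \subset K, connected_in K2,
    [/\ v \in K, v \notin K2 & touch v K2],
    {in T, forall t, edge t v || touch t K2} & e \in T /\ ~~ touch e K2].
Proof.
move=> cK x0K TK; pose bad X := [&& conn X, X \subset K & ~~ [forall t in T, touch t X]].
have [/forall_inP x0T|x0T] := boolP [forall t in T, touch t [set x0]].
  by left=> t /x0T; rewrite touch1.
right; have bad0 : bad [set x0].
  by rewrite /bad x0T sub1set x0K !andbT; apply/connP/connected1.
have [K2 /maxsetP[/and3P[/connP c2 s2 n2] max2] sx0] := maxset_exists bad0.
move: n2; rewrite negb_forall_in => /exists_inP[e eT ne].
have [|v vK vN2] := subsetPn (_ : ~~ (K \subset K2)).
  by apply: contra ne => sK2; apply: touch_sub (TK e eT).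
have x02 : x0 \in K2 by rewrite -sub1set.
have [a [b [aK a2 bK bN2 ab]]] := connected_exit cK x0K x02 vK vN2.
have bt : touch b K2 by apply/touchP; exists a; rewrite // edge_sym.
exists K2, b, e; split=> //.
(* By maximality, [K2] together with b dominates T. *)
have : ~~ bad (b |: K2).
  by apply/negP => /max2 /(_ (subsetUr _ _)) E; rewrite -E setU11 in bN2.
rewrite /bad subUset sub1set bK s2 (introT (connP _) (connected_add c2 bt)) /= negbK.
by move=> /forall_inP dom t /dom; rewrite touchU touch1.
Qed.

Let N := chain_bound k.
(** Bounds all sets guessed in a round: with fewer than N exposed vertices, H has at most kN
    elements, V with one vertex added at most 2kN + 1, and each seed set at most 2k^2 N + k + 1. *)
Let m := 4 * (k * k * N).

Let N_gt0 : 0 < N.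
Proof. by rewrite !muln_gt0 k_gt0 expn_gt0. Qed.

(* [E] is the set of exposed vertices chosen so far; [H] adds to it vertices of
   [B], and [V] consists of vertices of [A'], whose neighbourhoods guarantee that
   later exposed vertices share no neighbour with those of [E]. *)
Record stage E H V K : Prop := Stage {
  stage_ES : E \subset S;
  stage_EH : E \subset H;
  stage_indep : independent E;
  stage_single : {in A' :|: B, forall x,
    {in E &, forall t t', edge t x -> edge t' x -> t = t'}};
  stage_fresh : {in open_part H V & E, forall t e,
    {in A' :|: B, forall x, ~~ (edge t x && edge e x)}};
  stage_HS : H \subset S :|: B;
  stage_VA : V \subset A';
  stage_conn : connected_in K;
  stage_KA : K \subset A';
  stage_HK : {in H, forall h, ~~ touch h K};
  stage_dom : {in open_part H V, forall t, touch t K};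
  stage_cardH : #|H| <= k * #|E|;
  stage_cardV : #|V| <= 2 * k * #|E| }.

Lemma open_partS H H' V V' : H \subset H' -> V \subset V' ->
  open_part H' V' \subset open_part H V.
Proof.
move=> sH sV; apply/subsetP => t; rewrite !inE => /and3P[-> nH nV] /=.
by rewrite (contra (subsetP (cnbhdS sH) t) nH) (contra (subsetP (cnbhdS sV) t) nV).
Qed.

Lemma stage_card E H V K : stage E H V K -> #|E| < N.
Proof.
move=> st; have sE := subsetP (stage_ES st).
apply: (long_independent_false free k_gt0 noladder cA' cB).
- exact: disjointWl sA' dAB.
- exact: anticompleteS sA' (subxx _) acAB.
- move=> t /sE tS; split; [exact: domA'|by case: (inS_B tS)|].
  rewrite inE negb_or; case: (inS_B tS) => -> _; rewrite andbT.
  by apply/negP => /(subsetP sA'); apply/negP; case: (inS_A tS).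
- exact: stage_indep st.
- exact: stage_single st.
Qed.

(** [hub_cover] is applied twice with hub e and far side [K2]: W deals with the neighbours of e in
    B, U with those in A' away from [K2]. Neighbours of e in A' that touch [K2] lie in its frontier,
    which enters V as a whole; it also contains v, so all vertices left open touch [K2]. H gains at
    most k vertices and V fewer than 2k. *)
Lemma stage_next E H V K K2 v e : stage E H V K -> K2 \subset K ->
  connected_in K2 -> v \in K -> v \notin K2 -> touch v K2 ->
  {in open_part H V, forall t, edge t v || touch t K2} ->
  e \in open_part H V -> ~~ touch e K2 ->
  exists H' V', [/\ stage (e |: E) H' V' K2, H \subset H' & #|e |: E| = #|E|.+1].
Proof.
move=> st s2 c2 vK vN2 vt dom2 eT ne2; set T := open_part H V in dom2 eT.
have sKA := subset_trans (stage_KA st) sA'; have s2A := subset_trans s2 sKA.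
have [eS eH eV] : [/\ e \in S, e \notin cnbhd H & e \notin cnbhd V].
  by move: eT; rewrite inE => /and3P[].
have [eA _] := inS_A eS; have [eB _] := inS_B eS.
have eN2 : e \notin K2 by apply: contra eA; apply: (subsetP s2A).
pose T1 := [set t in T | ~~ edge t e & touch t K2].
pose XB := [set x in B | edge e x].
pose XA := [set x in A' | [&& edge e x, x \notin K2 & ~~ touch x K2]].
have [||W [sW Wk Wcov]] := @hub_cover e K2 XB [set t in T1 | touch t XB] c2 eN2 ne2.
- move=> x; rewrite inE => /andP[xB ex]; split=> //.
    by apply: contraTN xB => /(subsetP s2A)/(disjointFr dAB)->.
  by apply/touchNP => y /(subsetP s2A) yA; rewrite edge_sym acAB.
- by move=> t; rewrite !inE => /andP[/and3P[]].
have [||U [sU Uk Ucov]] := @hub_cover e K2 XA [set t in T1 | touch t XA] c2 eN2 ne2.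
- by move=> x; rewrite inE => /and4P[].
- by move=> t; rewrite !inE => /andP[/and3P[]].
have s2A' := subset_trans s2 (stage_KA st).
exists (e |: (H :|: W)), (V :|: (frontier K2 :|: U)).
set H' := e |: (H :|: W); set V' := V :|: (frontier K2 :|: U).
have sHH' : H \subset H' by rewrite /H' setUCA subsetUl.
have sVV' : V \subset V' by apply: subsetUl.
have sT' := subsetP (open_partS sHH' sVV'); rewrite -/T in sT'.
have vF : v \in frontier K2 by rewrite inE vN2 vt (subsetP (stage_KA st)).
have T'P t : t \in open_part H' V' -> [/\ t \in T1, t != e,
    ~~ touch t W, ~~ touch t U & ~~ touch t (frontier K2)].
  move=> tT'; have tT := sT' t tT'; move: tT'.
  rewrite inE !in_cnbhd !touchU touch1 !in_setU in_set1.
  rewrite !negb_or => /and3P[tS /andP[/and3P[te _ _] /and3P[nte _ ntW]]].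
  case/and4P=> _ _ ntF ntU.
  split=> //; rewrite inE tT nte /=.
  by case/orP: (dom2 t tT) => // tv; case/touchP: ntF; exists v.
have fresh t x : t \in open_part H' V' -> x \in A' :|: B -> ~~ (edge t x && edge e x).
  move=> /T'P[tT1 _ ntW ntU ntF]; rewrite inE; apply: contraL => /andP[tx ex].
  rewrite negb_or; apply/andP; split; apply/negP => xAB; last first.
    case/negP: ntW; apply: Wcov; rewrite inE tT1.
    by apply/touchP; exists x; rewrite // inE xAB.
  have xN2 : x \notin K2 by apply: contraL ex; apply: (elimT (touchNP _ _) ne2).
  have [xt2|nx2] := boolP (touch x K2).
    by case/negP: ntF; apply/touchP; exists x; rewrite // inE xAB xN2.
  case/negP: ntU; apply: Ucov; rewrite inE tT1.
  by apply/touchP; exists x; rewrite // inE xAB ex xN2.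
have eE : e \notin E.
  apply: contra eH => /(subsetP (stage_EH st)) eH.
  by rewrite in_cnbhd eH.
have nEe t : t \in E -> ~~ edge e t.
  move=> /(subsetP (stage_EH st)) tH; move: eH; rewrite in_cnbhd negb_or => /andP[_].
  by move/touchNP; apply.
have cardE : #|e |: E| = #|E|.+1 by rewrite cardsU1 eE.
split=> //; split.
- by rewrite subUset sub1set eS (stage_ES st).
- rewrite subUset sub1set setU11 /=; exact: subset_trans (stage_EH st) sHH'.
- move=> t t'; rewrite !in_setU1 => /orP[/eqP->|tE] /orP[/eqP->|t'E].
  + by rewrite edge_irrefl.
  + exact: nEe.
  + by rewrite edge_sym nEe.
  + exact: stage_indep st _ _ tE t'E.
- have efresh := stage_fresh st eT.
  move=> x xAB t t'; rewrite !in_setU1 => /orP[/eqP->|tE] /orP[/eqP->|t'E] tx t'x //.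
  + by move: (efresh t' t'E x xAB); rewrite tx t'x.
  + by move: (efresh t tE x xAB); rewrite tx t'x.
  + exact: (stage_single st xAB).
- move=> t t' tT'; rewrite in_setU1 => /orP[/eqP->|t'E] x xAB; first exact: fresh.
  exact: (stage_fresh st (sT' t tT') t'E).
- rewrite !subUset sub1set inE eS (stage_HS st) /=.
  apply: subset_trans (subsetUr _ _); apply: subset_trans sW _.
  by apply/subsetP => x; rewrite inE => /andP[].
- rewrite !subUset (stage_VA st) /=; apply/andP; split.
    by apply/subsetP => x; rewrite inE => /andP[].
  apply: subset_trans sU _.
  by apply/subsetP => x; rewrite inE => /andP[].
- exact: c2.
- exact: s2A'.
- move=> h; rewrite !in_setU in_set1 => /or3P[/eqP->//|hH|hW].
    by apply: contra (stage_HK st hH); apply: touch_sub.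
  have := subsetP sW h hW; rewrite inE => /andP[hB _].
  by apply/touchNP => y /(subsetP s2A) yA; rewrite edge_sym acAB.
- by move=> t /T'P[]; rewrite inE => /and3P[].
- rewrite cardE mulnS; apply: leq_trans (leq_card_setU _ _) _; rewrite cards1.
  have := leq_of_leqif (leq_card_setU H W); move: Wk (stage_cardH st).
  by move: (k * _) #|_ :|: _| #|H| #|W| => a b c d; clear; lia.
- rewrite cardE mulnS; apply: leq_trans (leq_card_setU _ _) _.
  have := leq_of_leqif (leq_card_setU (frontier K2) U); have := frontier_small c2 s2A'.
  move: Uk (stage_cardV st).
  by move: (_ * #|E|) #|_ :|: _| #|V| #|U| #|frontier K2| => a b c d f; clear; lia.
Qed.

(** Here n counts the rounds left. Each descent adds a vertex to E, and [#|E|] stays below N, so the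
    descent ends before the rounds run out. *)
Lemma stage_reachable n E H V K : stage E H V K -> N <= #|E| + n ->
  exists2 C, C \in reachable G m n & C \subset A /\ K \subset C.
Proof.
elim: n E H V K => [|n IHn] E H V K st leN.
  by have := stage_card st; rewrite ltnNge -[#|E|]addn0 leN.
have cardE := stage_card st.
(* One round upwards, with v put into V: what H and V leave open is adjacent to v or touches [K2].
   If one vertex [x0] of K is adjacent to all of it, [x0] takes the place of v, nothing stays open,
   and the round starts from the empty set. *)
have finish C K2 v : C \in reachable G m n -> C \subset A -> K2 \subset C ->
    v \in K -> {in H, forall h, ~~ touch h K2} ->
    open_part H (v |: V) = set0 \/
      connected_in K2 /\ {in open_part H (v |: V), forall t, touch t K2} ->
    exists2 C', C' \in reachable G m n.+1 & C' \subset A /\ K \subset C'.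
  move=> Cn sC s2 vK nH2 TK2.
  have sV : v |: V \subset A'.
    by rewrite subUset sub1set (subsetP (stage_KA st)) // (stage_VA st).
  have [A0 [B0 [cA0 cB0 sCA sKC]]] := guess_step_correct sC s2 (stage_HS st) sV
    (stage_KA st) (stage_conn st) (stage_HK st) nH2 TK2.
  exists (guess_step C H (v |: V) A0 B0) => //.
  have cV : #|v |: V| <= 2 * k * N + 1.
    apply: leq_trans (leq_card_setU _ _) _; rewrite cards1 addnC leq_add2r.
    apply: leq_trans (stage_cardV st) _; by rewrite leq_mul2l (ltnW cardE) orbT.
  have cH : #|H| <= k * N.
    apply: leq_trans (stage_cardH st) _; by rewrite leq_mul2l (ltnW cardE) orbT.
  have kN : k * N <= k * k * N by rewrite -mulnA leq_pmull.
  have Nk : N <= k * N by rewrite leq_pmull.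
  have kkH : k * #|H| <= k * k * N by rewrite -mulnA leq_mul2l cH orbT.
  have kkV : k * #|v |: V| <= 2 * (k * k * N) + k.
    apply: leq_trans (_ : k * (2 * k * N + 1) <= _); first by rewrite leq_mul2l cV orbT.
    by rewrite mulnDr muln1 leq_add2r !mulnA [k * 2]mulnC.
  have kle : k <= k * N by rewrite leq_pmulr.
  apply: reachable_step => //.
  - by move: cH kN; rewrite /m; clear; lia.
  - move: cV kN Nk N_gt0; rewrite -mulnA /m; clear; lia.
  - by move: cA0 kkV kle kN Nk N_gt0; rewrite /m; clear; lia.
  - by move: cB0 kkH kN Nk N_gt0; rewrite /m; clear; lia.
have [/set0Pn[x0 x0K] _] := stage_conn st.
have [Tx0|[K2 [v [e [s2 c2 [vK vN2 vt] dom2 [eT ne]]]]]] :=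
    exposed_vertex (stage_conn st) x0K (stage_dom st).
  apply: (finish set0 set0 x0); rewrite ?sub0set ?reachable0 //.
    by move=> h _; rewrite touch0.
  left; apply/setP => t; rewrite in_set0; apply/negP => tT.
  have := Tx0 t (subsetP (open_partS (subxx H) (subsetUr _ _)) t tT).
  move: tT; rewrite inE => /and3P[_ _]; rewrite in_cnbhd touchU touch1 !negb_or.
  by case/and3P=> _ /negbTE->.
have [H' [V' [st' sHH' cE]]] := stage_next st s2 c2 vK vN2 vt dom2 eT ne.
have [|C Cn [sC s2C]] := IHn _ _ _ _ st'; first by rewrite cE addSnnS.
apply: (finish C K2 v) => //.
  by move=> h hH; apply: contra (stage_HK st hH); apply: touch_sub.
right; split=> // t tT.
have := dom2 t (subsetP (open_partS (subxx H) (subsetUr _ _)) t tT).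
move: tT; rewrite inE => /and3P[_ _]; rewrite in_cnbhd touchU touch1 !negb_or.
by case/and3P=> _ /negbTE->.
Qed.

Lemma component_reachable : exists2 C, C \in reachable G m N &
  C \subset A /\ {in S, forall t, touch t C}.
Proof.
have [|C Cn [sC sAC]] := @stage_reachable N set0 set0 set0 A' _ (leq_addl _ _).
  split; rewrite ?sub0set ?cards0 //.
  - by move=> t t'; rewrite inE.
  - by move=> x _ t t'; rewrite inE.
  - by move=> t t' _; rewrite inE.
  - by move=> h; rewrite inE.
  - by move=> t; rewrite inE => /andP[/domA'].
by exists C => //; split=> // t /domA'; apply: touch_sub.
Qed.

End Reconstruction.


(** * Counting *)

Section Counting.
Variable G : sgraph.
Implicit Types (S A B C : {set G}).

(** Sets of at most m elements are read off m-tuples over [option T]; [None] is padding and explains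
    the successor in the base. *)
Lemma card_small_sets (T : finType) m :
  #|[set X : {set T} | #|X| <= m]| <= #|T|.+1 ^ m.
Proof.
have <- : #|{: m.-tuple (option T)}| = #|T|.+1 ^ m by rewrite card_tuple card_option.
pose f (s : m.-tuple (option T)) := [set x | Some x \in s].
rewrite -[leqRHS]cardsT; apply: leq_trans (leq_imset_card f _).
apply/subset_leq_card/subsetP => X; rewrite inE => leX.
apply/imsetP.
pose s := [seq Some x | x <- enum X] ++ nseq (m - #|X|) None.
have sm : size s == m by rewrite size_cat size_map size_nseq -cardE subnKC.
exists (Tuple sm); first by rewrite inE.
apply/setP => x; rewrite inE (_ : (_ \in Tuple sm) = (Some x \in s)) //.
rewrite mem_cat mem_nseq andbF orbF; apply/idP/mapP => [xX|[y yX [->]]].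
  by exists x; rewrite ?mem_enum.
by rewrite mem_enum in yX.
Qed.

Lemma card_guesses m : #|guesses G m| <= #|G|.+1 ^ (4 * m).
Proof.
rewrite !cardsX (_ : 4 * m = m + m + (m + m)); last by lia.
by rewrite !expnD; do 2!apply: leq_mul; apply: card_small_sets.
Qed.

Lemma card_reachable m n : #|reachable G m n| <= #|G|.+1 ^ (4 * m * n).
Proof.
elim: n => [|n IHn]; first by rewrite muln0 cards1.
apply: leq_trans (leq_imset_card _ _) _; rewrite cardsX mulnS addnC expnD.
exact: leq_mul IHn (card_guesses m).
Qed.

Let conn_sym S : connect_sym (induced_rel (~: S)).
Proof.
apply: sym_connect_sym => a b.
by rewrite /induced_rel /= edge_sym [(b \in ~: S) && _]andbC.
Qed.

Lemma component_connected S A : A \in components S -> connected_in A.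
Proof.
case/imsetP=> x xS AE.
have AP y : (y \in A) = (y \in ~: S) && connect (induced_rel (~: S)) x y.
  by rewrite AE inE.
have xA : x \in A by rewrite AP xS connect0.
apply: (connected_intro xA) => Z xZ closedZ; apply/subsetP => y.
rewrite AP => /andP[_ /connectP[p]].
elim: p {xS} x xA xZ {AE} AP => [|z p IHp] u uA uZ AP /=; first by move=> _ ->.
case/andP=> uz pP yE; have /andP[/andP[_ zS] uz'] := uz.
have zA : z \in A by rewrite AP zS connect1.
apply: (IHp z) => // [|v]; first exact: closedZ uz'.
by rewrite AP (same_connect (conn_sym S) (connect1 uz)).
Qed.

Lemma component_eq S A B y : A \in components S -> B \in components S ->
  y \in A -> y \in B -> A = B.
Proof.
case/imsetP=> a _ -> /imsetP[b _ ->]; rewrite !inE => /andP[_ ay] /andP[_ by_].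
apply/setP => z; rewrite !inE (same_connect (conn_sym S) ay).
by rewrite (same_connect (conn_sym S) by_).
Qed.

Lemma minimal_separatorP S : minimal_separator S -> exists A B,
  [/\ connected_in A, connected_in B, [disjoint A & B], nbhd A = S & nbhd B = S].
Proof.
case/card_gt1P=> A [B []]; rewrite !inE => /andP[cA /eqP nA] /andP[cB /eqP nB] AB.
exists A, B; split=> //.
- exact: component_connected cA.
- exact: component_connected cB.
apply/pred0P => y /=; apply: contraNF AB => /andP[yA yB].
by rewrite (component_eq cA cB yA yB).
Qed.

Lemma separator_reachable k S : creature_free G k -> 0 < k ->
  ~ induced_minor (skinny_ladder k) G -> minimal_separator S ->
  exists C b, C \in reachable G (4 * (k * k * chain_bound k)) (chain_bound k)
    /\ S = nbhd (grow [set b] (~: cnbhd C)).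
Proof.
move=> free k_gt0 noladder /minimal_separatorP[A [B [cA cB dAB nA nB]]].
have SA s : s \in S -> touch s A by rewrite -nA in_nbhd => /andP[].
pose P X := [&& conn X, X \subset A & [forall s in S, touch s X]].
have PA : P A.
  by rewrite /P subxx andTb; apply/andP; split; [apply/connP|apply/forall_inP].
have [A' /minsetP[/and3P[/connP cA' sA' /forall_inP domA'] minA'] _] := minset_exists PA.
have [|C Cn [sCA domC]] := component_reachable free k_gt0 noladder cB dAB nA nB cA' sA' domA'.
  move=> K sK cK domK; apply: (minA' K _ sK); rewrite /P (subset_trans sK sA').
  by apply/andP; split; [apply/connP|apply/forall_inP].
have [/set0Pn[b bB] _] := cB; exists C, b; split=> //.
suff <- : B = grow [set b] (~: cnbhd C) by [].
have BC x : x \in B -> x \in ~: cnbhd C.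
  move=> xB; rewrite inE in_cnbhd negb_or; apply/andP; split.
    by apply: contraTN xB => /(subsetP sCA)/(disjointFr dAB)->.
  apply/touchNP => a /(subsetP sCA) aA; apply/negP => xa.
  have : x \in S.
    rewrite -nA in_nbhd (disjointFl dAB xB) /=.
    by apply/touchP; exists a.
  by rewrite -nB in_nbhd xB.
apply/eqP; rewrite eqEsubset; apply/andP; split.
  apply: grow_absorb cB _ bB _; first by apply/subsetP.
  by rewrite (subsetP (grow_base _ _)) ?set11.
apply: grow_ind => [|x y xB yC xy]; first by rewrite sub1set.
apply: contraLR yC => yB; rewrite inE negbK in_cnbhd domC ?orbT //.
rewrite -nB in_nbhd yB; apply/touchP; exists x; rewrite // edge_sym.
by [].
Qed.

(** A separator is coded by a reachable C and a vertex b of B; the choice of b is the summand 1 in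
    the exponent. *)
Lemma card_minimal_separators k : creature_free G k -> 0 < k ->
  ~ induced_minor (skinny_ladder k) G ->
  #|[set S : {set G} | minimal_separator S]|
    <= #|G|.+1 ^ (4 * (4 * (k * k * chain_bound k)) * chain_bound k + 1).
Proof.
move=> free k_gt0 noladder.
pose f (x : {set G} * G) := nbhd (grow [set x.2] (~: cnbhd x.1)).
pose codes := setX (reachable G (4 * (k * k * chain_bound k)) (chain_bound k)) [set: G].
apply: leq_trans (_ : #|f @: codes| <= _).
  apply/subset_leq_card/subsetP => S; rewrite inE => msS.
  have [C [b [Cn SE]]] := separator_reachable free k_gt0 noladder msS.
  by apply/imsetP; exists (C, b); rewrite // inE /= Cn inE.
apply: leq_trans (leq_imset_card _ _) _; rewrite cardsX expnD expn1 cardsT.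
by apply: leq_mul (leqnSn _); apply: card_reachable.
Qed.
End Counting.

(** * The case k = 0 and the degree estimate *)

Lemma ladder0_minor (G : sgraph) : induced_minor (skinny_ladder 0) G.
Proof.
apply: (minor_model_induced (f := fun=> set0)).
have no : skinny_ladder 0 -> False by case=> [[i|i]|i]; case: i.
by split=> h; case: (no h).
Qed.

(** For k > c already k^2 exceeds the base c; the constant pays for the finitely many k up to c. *)
Lemma exp_le_square_exp c : exists2 C, 0 < C &
  forall k, 0 < k -> c ^ k <= C * (k ^ 2) ^ k.
Proof.
exists (c.+1 ^ c) => [|k k_gt0]; first by rewrite expn_gt0.
have [kc|ck] := leqP k c.
  apply: leq_trans (_ : c.+1 ^ c <= _); last by rewrite leq_pmulr // !expn_gt0 k_gt0.
  apply: leq_trans (_ : c.+1 ^ k <= _); first by rewrite leq_exp2r.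
  by rewrite leq_exp2l // ltnS (leq_trans k_gt0).
apply: leq_trans (_ : (k ^ 2) ^ k <= _); last by rewrite leq_pmull // expn_gt0.
by rewrite leq_exp2r // (leq_trans (ltnW ck)) // -{1}[k]expn1 leq_pexp2l.
Qed.

(** The exponent is 16 k^6 (16^12)^k + 1. On the right, powers of k alone contribute k^7 (k^2)^k,
    and (k^2)^k absorbs (16^12)^k up to a constant; the factor 17 in place of 16 absorbs the summand
    1. *)
Lemma exponent_bound : exists2 C, 0 < C & forall k, 0 < k ->
  4 * (4 * (k * k * chain_bound k)) * chain_bound k + 1
    <= C * k ^ 3 * (8 * k ^ 2) ^ (k + 2).
Proof.
have [C C_gt0 CP] := exp_le_square_exp (16 ^ 12).
exists (17 * C) => [|k k_gt0]; first by rewrite muln_gt0.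
have cE : 16 ^ (6 * k) * 16 ^ (6 * k) = (16 ^ 12) ^ k.
  by rewrite -expnD -mulnDl -expnM.
have lhsE : 4 * (4 * (k * k * chain_bound k)) * chain_bound k
    = 16 * (k ^ 6 * (16 ^ 12) ^ k).
  rewrite -cE /chain_bound; move: (16 ^ (6 * k)) => a.
  by rewrite !expnS expn0; clear; lia.
have rhs : C * k ^ 3 * (8 * k ^ 2) ^ (k + 2) >= k ^ 6 * (C * (k ^ 2) ^ k).
  have -> : C * k ^ 3 * (8 * k ^ 2) ^ (k + 2)
      = (k * 8 ^ (k + 2)) * (k ^ 6 * (C * (k ^ 2) ^ k)).
    rewrite expnMn [(k ^ 2) ^ (k + 2)]expnD.
    move: ((k ^ 2) ^ k) (8 ^ (k + 2)) => a b.
    by rewrite !expnS !expn0; clear; lia.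
  by rewrite leq_pmull // muln_gt0 k_gt0 expn_gt0.
have le1 : k ^ 6 * (16 ^ 12) ^ k <= C * k ^ 3 * (8 * k ^ 2) ^ (k + 2).
  by apply: leq_trans rhs; rewrite leq_mul2l CP ?orbT.
have ge1 : 0 < k ^ 6 * (16 ^ 12) ^ k by rewrite muln_gt0 !expn_gt0 k_gt0.
have -> : 17 * C * k ^ 3 * (8 * k ^ 2) ^ (k + 2)
    = 17 * (C * k ^ 3 * (8 * k ^ 2) ^ (k + 2)) by rewrite !mulnA.
rewrite lhsE; move: le1 ge1.
by move: (k ^ 6 * _) (C * k ^ 3 * _) => a b; clear; lia.
Qed.

Local Open Scope ring_scope.

Theorem theorem2 (R : realType) :
  exists C : R, 0 < C /\
  forall k : nat, exists q : {poly R},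
    (size q).-1%:R <= C * k%:R ^+ 3 * (8 * k%:R ^+ 2) ^+ (k + 2) /\
    forall G : sgraph,
      creature_free G k -> ~ induced_minor (skinny_ladder k) G ->
      #|[set S : {set G} | minimal_separator S]|%:R <= q.[#|G|%:R].
Proof.
have [C C_gt0 CP] := exponent_bound.
exists C%:R; split=> [|[|k]]; first by rewrite ltr0n.
  (* For k = 0 the ladder is empty and an induced minor of every graph, so no graph is to be
     bounded. *)
  exists 1; split=> [|G _ []]; last exact: ladder0_minor.
  by rewrite size_poly1 expr0n mulr0 mul0r.
pose d := (4 * (4 * (k.+1 * k.+1 * chain_bound k.+1)) * chain_bound k.+1 + 1)%N.
(* The count is at most a power of n + 1, the value of X + 1 at n. *)
exists (('X + 1%:P) ^+ d); split=> [|G free noladder].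
  have size_d : ((size (('X + 1%:P : {poly R}) ^+ d)).-1 <= d)%N.
    have := size_poly_exp_leq ('X + 1%:P : {poly R}) d.
    by rewrite size_XaddC mul1n; case: (size _).
  apply: le_trans (_ : d%:R <= _); first by rewrite ler_nat.
  have := CP k.+1 isT; rewrite -/d -(ler_nat R) !(natrM, natrX); exact.
rewrite horner_exp hornerD hornerX hornerC natr1 -natrX ler_nat.
exact: card_minimal_separators.
Qed.
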